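(* Let $G_1$ and $G_2$ be graphs and let $S = (G_1 \odot G_2, \sigma)$ be a signed graph whose underlying graph is the corona product of $G_1$ and $G_2$, with an arbitrary signature $\sigma$. If $\Delta(G_1) \geq 2$, then $\chi'(S) = \Delta(S)$.
   Context: All graphs are simple, finite and undirected, and have at least one vertex. $\Delta(G)$ denotes the maximum degree of $G$ and $n(G)$ the number of vertices of $G$. A signed graph is a pair $S=(G,\sigma)$ where $G$ is a graph (the underlying graph) and $\sigma\colon E(G)\to\{+1,-1\}$ (the signature); $\Delta(S)$ refers to the underlying graph. An incidence is a pair $v\text{:}e$ of a vertex $v$ and an edge $e$ having $v$ as an endpoint; $I(G)$ is the set of all incidences. For a positive integer $k$ let $M_k=\{0,\pm1,\ldots,\pm l\}$ if $k=2l+1$ and $M_k=\{\pm1,\ldots,\pm l\}$ if $k=2l$. A $k$-edge-coloring of $S=(G,\sigma)$ is a function $f\colon I(G)\to M_k$ such that $f(u\text{:}uv)=-\sigma(uv)f(v\text{:}uv)$ for each edge $uv$, and $f(u\text{:}uv_1)\neq f(u\text{:}uv_2)$ for any two distinct edges $uv_1\neq uv_2$ at a common vertex $u$. The chromatic index $\chi'(S)$ is the smallest $k$ for which $S$ has a $k$-edge-coloring. The corona product $G_1\odot G_2$ is the graph obtained from the disjoint union of $G_1$ and $n(G_1)$ copies $G_2^1,\ldots,G_2^{n(G_1)}$ of $G_2$ by joining, for each $i$, the $i$-th vertex of $G_1$ by an edge to every vertex of $G_2^i$. *)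

(* Defs.v *)
From mathcomp Require Import all_boot all_order all_algebra.

Set Implicit Arguments.
Unset Strict Implicit.
Unset Printing Implicit Defensive.

Record sgraph := SGraph {
  vertex :> finType;
  adj : rel vertex;
  adj_sym : symmetric adj;
  adj_irr : irreflexive adj;
  vertex_gt0 : 0 < #|vertex|
}.

Definition degree (G : sgraph) (v : G) : nat := #|[set u : G | adj v u]|.

Definition max_degree (G : sgraph) : nat := \max_(v : G) degree v.

Definition edge_set (G : sgraph) : {set {set G}} :=
  [set [set x; y] | x in G, y in G & adj x y].

Definition edge (G : sgraph) := {e : {set G} | e \in edge_set G}.

Definition incidence (G : sgraph) := {p : G * edge G | p.1 \in val p.2}.

Definition inc_vertex (G : sgraph) (i : incidence G) : G := (val i).1.
Definition inc_edge (G : sgraph) (i : incidence G) : edge G := (val i).2.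

Record signature (G : sgraph) := Signature {
  sign :> edge G -> int;
  sign_pm1 : forall e : edge G, sign e = 1%R \/ sign e = (-1)%R
}.

Record signed_graph := SignedGraph {
  underlying :> sgraph;
  sigma : signature underlying
}.

(* M_k: the integers of absolute value at most floor(k/2), without 0 when k is
   even. *)
Definition colors (k : nat) : pred int :=
  [pred c : int | (`|c|%N <= k./2) && (odd k || (c != 0%R))].

(* Two incidences on the same edge at distinct vertices are its two ends. *)
Definition is_edge_coloring (S : signed_graph) (k : nat)
    (f : incidence S -> int) : Prop :=
  [/\ forall i, f i \in colors k,
      forall i j, inc_edge i = inc_edge j -> inc_vertex i <> inc_vertex j ->
        f i = (- sigma S (inc_edge i) * f j)%R
    & forall i j, inc_vertex i = inc_vertex j -> inc_edge i <> inc_edge j ->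
        f i <> f j].

Definition edge_colorable (S : signed_graph) (k : nat) : Prop :=
  exists f : incidence S -> int, is_edge_coloring k f.

Definition is_chromatic_index (S : signed_graph) (k : nat) : Prop :=
  [/\ 0 < k, edge_colorable S k
    & forall m, 0 < m -> edge_colorable S m -> k <= m].

Section Corona.
Variables G1 G2 : sgraph.

(* inl v is the vertex v of G1; inr (v, a) is the vertex a in the copy of G2
   attached to v. *)
Definition corona_vertex : finType := (G1 + G1 * G2)%type.

Definition corona_adj : rel corona_vertex := fun p q =>
  match p, q with
  | inl x, inl y => adj x y
  | inl x, inr (y, _) => x == y
  | inr (x, _), inl y => x == y
  | inr (x, a), inr (y, b) => (x == y) && adj a b
  end.

Lemma corona_adj_sym : symmetric corona_adj.
Proof.
by move=> [x|[x a]] [y|[y b]] /=; rewrite ?(adj_sym x) ?(adj_sym a) // eq_sym.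
Qed.

Lemma corona_adj_irr : irreflexive corona_adj.
Proof. by move=> [x|[x a]] /=; rewrite adj_irr ?andbF. Qed.

Lemma corona_vertex_gt0 : 0 < #|corona_vertex|.
Proof. by rewrite card_sum ltn_addr ?vertex_gt0. Qed.

Definition corona : sgraph :=
  SGraph corona_adj_sym corona_adj_irr corona_vertex_gt0.

End Corona.

(* Main.v *)
Require Import Defs.
From mathcomp Require Import all_boot all_order all_algebra.
From mathcomp Require Import zify.

(* The colours +-1, ..., +-l are coded as pairs in 'I_l * bool (class and sign);
   colour 0 is treated separately.  A vertex v is added to a graph coloured with +-1, ..., +-l by
   matching its neighbours N injectively to colours missing at them, after
   switching so that all edges at v are negative.  Take a colouring and a partial
   matching M that saturates as many vertices of N as possible and, subject to
   that, has as many vertices as possible with an alternating path to an unused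
   colour b.  A longest alternating path from an unsaturated vertex yields three
   vertices y, z, w missing a common colour a, with y unsaturated, w matched to a,
   and an alternating path from y to z avoiding a.  Swapping a with b and -a with
   -b along a Kempe chain from (y, a), (z, a) or (w, a) improves (colouring, M)
   unless the other end of the chain is matched by M to -a or -b; there are only
   two such ends, so one of the three chains improves.  Every neighbour needs two
   missing colours, except those in a set X that M keeps saturated throughout, at
   the cost of |X| further missing colours at each other neighbour.

   When k = Delta is even, the corona is built vertex by vertex, first G1, then
   the copies of G2, where X consists of the attachment vertex in G1: this is where
   Delta(G1) >= 2 is needed.  When k is odd, colour 0 goes first to a matching meeting
   every vertex of G1: one pendant edge at each vertex if G2 has at least two
   vertices, and otherwise a maximal matching of G1 together with the pendant
   edges at the unmatched vertices, which are pairwise nonadjacent. *)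

Set Implicit Arguments.
Unset Strict Implicit.
Unset Printing Implicit Defensive.

(** * Signed colourings and Kempe chains *)

Section SignedColors.
Variables (V : finType) (l : nat).

Definition color : finType := ('I_l * bool)%type.

Definition opp_color (c : color) : color := (c.1, ~~ c.2).

Definition twist (s : bool) (c : color) : color := if s then opp_color c else c.

Lemma opp_colorK : involutive opp_color.
Proof. by case=> i b; rewrite /opp_color /= negbK. Qed.

Lemma opp_color_neq c : (opp_color c == c) = false.
Proof. by case: c => i [] /=; rewrite xpair_eqE /= andbF. Qed.

Lemma twistK s : involutive (twist s).
Proof. by case: s => c //=; rewrite opp_colorK. Qed.

Lemma twist_addb s t c : twist (s (+) t) c = twist s (twist t c).
Proof. by case: s; case: t => //=; rewrite opp_colorK. Qed.

(** [f u w] is the colour of the incidence of [u] with the edge [uw]; [sg u w = true] codes a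
    positive edge, whose two ends carry opposite colours. *)
Definition proper (sg : V -> V -> bool) (e : rel V) (f : V -> V -> color) :=
  (forall u w, e u w -> f w u = twist (sg u w) (f u w)) /\
  (forall u w w', e u w -> e u w' -> f u w = f u w' -> w = w').

(** Pairs (vertex, colour), called slots below, serve both as positions on Kempe chains and as edges
    available to the matching. *)
Definition missing (e : rel V) (f : V -> V -> color) : {set V * color} :=
  [set p | [forall w, e p.1 w ==> (f p.1 w != p.2)]].

Definition deg (e : rel V) (u : V) := #|[set w | e u w]|.

Lemma missingP (e : rel V) (f : V -> V -> color) p :
  reflect (forall w, e p.1 w -> f p.1 w != p.2) (p \in missing e f).
Proof. by rewrite inE; apply: (iffP forallP) => H w; apply/implyP/H. Qed.

Lemma card_missing (e : rel V) (f : V -> V -> color) u :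
  l.*2 <= #|[set c | (u, c) \in missing e f]| + deg e u.
Proof.
have <- : #|color| = l.*2 by rewrite card_prod card_ord card_bool muln2.
rewrite -cardsT.
have sub : [set: color] \subset
  [set c | (u, c) \in missing e f] :|: f u @: [set w | e u w].
  apply/subsetP => c _; rewrite !inE /=.
  case: forallP => //= H; apply/imsetP.
  have /existsP[w] : [exists w, ~~ (e u w ==> (f u w != c))].
    by rewrite -negb_forall; apply/forallP.
  by rewrite negb_imply negbK => /andP[euw /eqP <-]; exists w; rewrite ?inE.
apply: leq_trans (subset_leq_card sub) _.
by rewrite cardsU; apply: leq_trans (leq_subr _ _) _; rewrite leq_add2l leq_imset_card.
Qed.

Section Kempe.
Variables (sg : V -> V -> bool) (e : rel V) (f : V -> V -> color).
Hypotheses (eC : symmetric e) (fP : proper sg e f).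
Variable th : color -> color.
Hypotheses (thK : involutive th) (thN : {morph th : c / opp_color c}).

Let Ms := missing e f.

(** If colour c occurs at u on the edge uw, the slot (u, c) is carried to the slot of the same edge
    at w; missing slots stay fixed, and these are the ends of chains. *)
Definition mate (p : V * color) : V * color :=
  if [pick w | e p.1 w && (f p.1 w == p.2)] is Some w then (w, f w p.1) else p.

Definition switch (p : V * color) : V * color := (p.1, th p.2).

Lemma mate_edge u w : e u w -> mate (u, f u w) = (w, f w u).
Proof.
move=> euw; rewrite /mate /=; case: pickP => [w' /andP[euw' /eqP E]|/(_ w)].
  by rewrite (fP.2 _ _ _ euw' euw E).
by rewrite euw eqxx.
Qed.

Lemma mate_missing p : p \in Ms -> mate p = p.
Proof.
move/missingP=> H; rewrite /mate; case: pickP => // w /andP[euw].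
by rewrite (negPf (H _ euw)).
Qed.

Lemma mateK : involutive mate.
Proof.
case=> u c; rewrite {2}/mate /=; case: pickP => [w /andP[euw /eqP <-]|/= N].
  by rewrite mate_edge // eC.
rewrite mate_missing //; apply/missingP => w /= euw.
by have := N w; rewrite euw /= => ->.
Qed.

Lemma switchK : involutive switch.
Proof. by case=> u c; rewrite /switch /= thK. Qed.

(** A chain alternates the involutions [switch] and [mate]; the orbit of a missing slot under their
    composite [g] is its Kempe chain. *)
Let g p := mate (switch p).

Lemma kempe_step_inj : injective g.
Proof. by apply: inj_comp (inv_inj mateK) (inv_inj switchK). Qed.

Let gC := fconnect_sym kempe_step_inj.

(** [switch] conjugates [g] to its inverse. As [mate] fixes the missing slot x, [switch x] is the
    inverse image of x under [g], so the orbit is mapped to itself. *)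
Lemma chain_switch x y : x \in Ms -> fconnect g x y -> fconnect g x (switch y).
Proof.
move=> xM /iter_findex <-; elim: (findex g x y) => [|n IH] /=.
  by rewrite gC -{2}(mate_missing xM) -{2}(switchK x) fconnect1.
have E : g (switch (g (iter n g x))) = switch (iter n g x).
  by rewrite {1}/g switchK mateK.
by apply: connect_trans IH _; rewrite gC -E fconnect1.
Qed.

Lemma chain_mate x y : x \in Ms -> fconnect g x y -> fconnect g x (mate y).
Proof.
move=> xM xy; have E : mate y = g (switch y) by rewrite /g switchK.
by rewrite E; apply: connect_trans (fconnect1 _ _); apply: chain_switch.
Qed.

Lemma iter_mate_iter x n : x \in Ms -> iter n g (mate (iter n g x)) = x.
Proof.
move=> xM; elim: n => [|n IH]; first exact: mate_missing.
suff E y : g (mate (g y)) = mate y by rewrite iterSr iterS E.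
by rewrite /g mateK switchK.
Qed.

(** Conjugation by [mate] inverts [g]. If [t], the i-th iterate at x, is also fixed by [mate], then
    2i steps lead from x back to x; as 0 < i < [order g x], this forces 2i to be the order. So i,
    and with it [t], is determined by x. *)
Lemma chain_ends x y z : x \in Ms -> y \in Ms -> z \in Ms ->
  fconnect g x y -> fconnect g x z -> y != x -> z != x -> y = z.
Proof.
move=> xM yM zM xy xz yx zx.
suff H t : t \in Ms -> fconnect g x t -> t != x ->
    (findex g x t).*2 = order g x.
  rewrite -(iter_findex xy) -(iter_findex xz); congr (iter _ g x).
  by apply: double_inj; rewrite !H.
move=> tM xt tx; set i := findex g x t.
have it : iter i g x = t by apply: iter_findex.
have E : iter (i + i) g x = x.
  by rewrite iterD it -[RHS](iter_mate_iter i xM) it mate_missing.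
have ilt : i < order g x by apply: findex_max.
have i0 : 0 < i by rewrite lt0n; apply: contraNneq tx => i0; rewrite -it i0.
have xx : iter (order g x) g x = x by apply: iter_order kempe_step_inj x.
have F j : j < order g x -> iter j g x = x -> j = 0.
  by move=> jlt jx; rewrite -(findex_iter jlt) jx findex0.
rewrite addnn in E.
have [lt|le] := ltnP i.*2 (order g x).
  by have := F _ lt E; lia.
have E2 : iter (i.*2 - order g x) g x = x.
  by move: E; rewrite -{1}(subnK le) iterD xx.
have := F _ _ E2; lia.
Qed.

Definition swap_chain x u w :=
  if fconnect g x (u, f u w) then th (f u w) else f u w.

Lemma thT s : {morph th : c / twist s c}.
Proof. by case: s => c //=; rewrite thN. Qed.

(** Closure of the chain under [mate] recolours both ends of an edge together, and closure under
    [switch] prevents a clash at a vertex between recoloured and unchanged edges. *)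
Lemma proper_swap x : x \in Ms -> proper sg e (swap_chain x).
Proof.
move=> xM; split=> [u w euw|u w w' euw euw'].
  rewrite /swap_chain -(mate_edge euw).
  have -> : fconnect g x (mate (u, f u w)) = fconnect g x (u, f u w).
    apply/idP/idP => H; last exact: chain_mate.
    by rewrite -[X in fconnect _ _ X]mateK; apply: chain_mate.
  by rewrite (fP.1 _ _ euw); case: ifP => // _; rewrite thT.
rewrite /swap_chain; have sw c : fconnect g x (u, c) -> fconnect g x (u, th c).
  by move/(chain_switch xM).
case: ifP => K1; case: ifP => K2.
- by move/(inv_inj thK); apply: fP.2.
- by move=> E; rewrite -E sw in K2.
- by move=> E; rewrite E sw in K1.
- exact: fP.2.
Qed.

Lemma missing_swap x p : x \in Ms ->
  (p \in missing e (swap_chain x)) =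
  ((if fconnect g x p then switch p else p) \in Ms).
Proof.
case: p => u c xM; rewrite !inE.
have sw d : fconnect g x (u, d) -> fconnect g x (u, th d).
  by move/(chain_switch xM).
have -> : (if fconnect g x (u, c) then switch (u, c) else (u, c)).1 = u.
  by case: ifP.
apply: eq_forallb => w /=; congr (_ ==> ~~ _); rewrite /swap_chain.
have [Kw|Kw] := boolP (fconnect g x (u, f u w)); have [Kc|Kc] := boolP (fconnect g x (u, c)) => //=.
- by rewrite (can2_eq thK thK).
- rewrite (can2_eq thK thK); apply/eqP/eqP => E.
    by rewrite -(thK c) -E sw in Kc.
  by rewrite -E Kw in Kc.
- apply/eqP/eqP => E; first by rewrite E Kc in Kw.
  by rewrite E sw in Kw.
Qed.

(** All that is used of Kempe chains later: [pi] exchanges the two ends of a chain, and swapping a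
    chain affects missing slots at its two ends only. *)
Lemma kempe_pairing : exists pi : V * color -> V * color,
  [/\ {in Ms, forall x, pi x \in Ms},
      {in Ms, involutive pi}
    & {in Ms, forall x, exists f', proper sg e f' /\
        [/\ forall p, p \in Ms -> p != x -> p != pi x -> p \in missing e f',
            switch x \in missing e f' & switch (pi x) \in missing e f']}].
Proof.
(* A chain without a second missing slot, such as one whose colour is fixed by [th], is paired with
   itself. *)
pose pi x := odflt x [pick y | [&& y \in Ms, fconnect g x y & y != x]].
have piM : {in Ms, forall x, pi x \in Ms}.
  by move=> x xM; rewrite /pi; case: pickP => //= y /and3P[].
have piK x : fconnect g x (pi x).
  by rewrite /pi; case: pickP => //= y /and3P[].
have uniq_end x y : x \in Ms -> y \in Ms -> fconnect g x y -> y != x -> y = pi x.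
  move=> xM yM xy yx; rewrite /pi; case: pickP => [z /and3P[zM xz zx]|/(_ y)] /=.
    exact: chain_ends xy xz yx zx.
  by rewrite yM xy yx.
exists pi; split=> // x xM.
  have [E|ne] := eqVneq (pi x) x; first by rewrite E.
  by rewrite -(@uniq_end (pi x) x) ?piM // ?(eq_sym x) // gC.
exists (swap_chain x); split; first exact: proper_swap.
split=> [p pM px ppi||].
- rewrite missing_swap //; case: ifP => // xp.
  by rewrite (uniq_end _ _ xM pM xp px) eqxx in ppi.
- by rewrite missing_swap // chain_switch // switchK.
- by rewrite missing_swap // chain_switch // switchK piM.
Qed.

End Kempe.

End SignedColors.

(** * Alternating paths *)

Section Alternating.
Variables V C : finType.
Implicit Types (Ms M : {set V * C}) (B : {set C}).

Definition matching Ms M :=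
  [/\ M \subset Ms,
      forall u c d, (u, c) \in M -> (u, d) \in M -> c = d
    & forall u w c, (u, c) \in M -> (w, c) \in M -> u = w].

Definition dom M := [set p.1 | p in M].
Definition cod M := [set p.2 | p in M].

Lemma domP M u : reflect (exists c, (u, c) \in M) (u \in dom M).
Proof.
apply: (iffP imsetP) => [[[v c] vM /= ->]|[c cM]]; first by exists c.
by exists (u, c).
Qed.

Lemma codP M c : reflect (exists u, (u, c) \in M) (c \in cod M).
Proof.
apply: (iffP imsetP) => [[[v d] vM /= ->]|[u uM]]; first by exists v.
by exists (u, c).
Qed.

Lemma card_dom Ms M : matching Ms M -> #|dom M| = #|M|.
Proof.
case=> _ Mf _; apply: card_in_imset => -[u c] [w d] uM wM /= E.
by rewrite -E in wM *; rewrite (Mf _ _ _ uM wM).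
Qed.

Lemma card_cod Ms M : matching Ms M -> #|cod M| = #|M|.
Proof.
case=> _ _ Mi; apply: card_in_imset => -[u c] [w d] uM wM /= E.
by rewrite -E in wM *; rewrite (Mi _ _ _ uM wM).
Qed.

Lemma matching_sub Ms Ms' M :
  matching Ms M -> (forall p, p \in M -> p \in Ms') -> matching Ms' M.
Proof. by case=> _ Mf Mi H; split=> //; apply/subsetP. Qed.

Lemma matching_subl Ms M M' : matching Ms M -> M' \subset M -> matching Ms M'.
Proof.
case=> MMs Mf Mi /subsetP H; split=> [|u c d /H ? /H|u w c /H ? /H].
- by apply/subsetP => p /H /(subsetP MMs).
- exact: Mf.
- exact: Mi.
Qed.

Lemma matching_add Ms M u c : matching Ms M -> (u, c) \in Ms ->
  u \notin dom M -> c \notin cod M -> matching Ms ((u, c) |: M).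
Proof.
case=> MMs Mf Mi ucM ud cc.
have ud' d : (u, d) \in M -> False by move=> H; case/domP: ud; exists d.
have cc' w : (w, c) \in M -> False by move=> H; case/codP: cc; exists w.
split.
- by rewrite subUset sub1set ucM.
- move=> w d d'; rewrite !inE !xpair_eqE.
  case/orP=> [/andP[/eqP -> /eqP ->]|wd]; case/orP=> [/andP[/eqP E1 /eqP E2]|wd'].
  + by [].
  + by case: (ud' _ wd').
  + by rewrite E1 in wd; case: (ud' _ wd).
  + exact: Mf wd wd'.
- move=> w w' d; rewrite !inE !xpair_eqE.
  case/orP=> [/andP[/eqP -> /eqP ->]|wd]; case/orP=> [/andP[/eqP E1 /eqP E2]|wd'].
  + by [].
  + by case: (cc' _ wd').
  + by rewrite E2 in wd; case: (cc' _ wd).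
  + exact: Mi wd wd'.
Qed.

Lemma dom_add M u c : dom ((u, c) |: M) = u |: dom M.
Proof. by rewrite /dom imsetU1. Qed.

Lemma cod_add M u c : cod ((u, c) |: M) = c |: cod M.
Proof. by rewrite /cod imsetU1. Qed.

Lemma dom_del Ms M u c : matching Ms M -> (u, c) \in M ->
  dom (M :\ (u, c)) = dom M :\ u.
Proof.
case=> _ Mf _ ucM; apply/setP => w; rewrite inE; apply/domP/andP.
  case=> d; rewrite !inE xpair_eqE => /andP[ne wd]; split; last by apply/domP; exists d.
  apply: contra ne => /eqP Ew; rewrite Ew eqxx /=.
  by rewrite Ew in wd; rewrite (Mf _ _ _ wd ucM).
case; rewrite inE => wu /domP[d wd]; exists d.
by rewrite !inE xpair_eqE (negPf wu).
Qed.

Lemma cod_del Ms M u c : matching Ms M -> (u, c) \in M ->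
  cod (M :\ (u, c)) = cod M :\ c.
Proof.
case=> _ _ Mi ucM; apply/setP => d; rewrite inE; apply/codP/andP.
  case=> w; rewrite !inE xpair_eqE => /andP[ne wd]; split; last by apply/codP; exists w.
  apply: contra ne => /eqP Ed; rewrite Ed eqxx andbT.
  by rewrite Ed in wd; rewrite (Mi _ _ _ wd ucM).
case; rewrite inE => dc /codP[w wd]; exists w.
by rewrite !inE xpair_eqE (negPf dc) andbF.
Qed.

(** A step from x to y means that x could take over the colour matched to y; [B] restricts the
    colours that may be handed over. *)
Definition step Ms M B : rel V := fun x y =>
  [exists d in B, ((x, d) \in Ms) && ((y, d) \in M)].

Lemma stepP Ms M B x y :
  reflect (exists d, [/\ d \in B, (x, d) \in Ms & (y, d) \in M]) (step Ms M B x y).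
Proof.
apply: (iffP existsP) => -[d]; first by case/and3P; exists d.
by case=> *; exists d; apply/and3P.
Qed.

Lemma path_step_dom Ms M B y p x : path (step Ms M B) y p -> x \in p ->
  exists d, d \in B /\ (x, d) \in M.
Proof.
elim: p y => //= z p IH y /andP[/stepP[d [dB _ zd]] zp].
by rewrite inE => /orP[/eqP ->|]; [exists d | apply: IH zp].
Qed.

(** Every vertex of the path takes the colour of its successor: the first vertex becomes saturated,
    the last one is freed, and the set of used colours is unchanged. *)
Lemma shift Ms B p : forall y M, matching Ms M -> y \notin dom M ->
  path (step Ms M B) y p -> uniq (y :: p) ->
  exists M', matching Ms M' /\
   [/\ cod M' = cod M,
       dom M' = (y |: dom M) :\ last y p,
       forall x c, x \notin y :: p -> ((x, c) \in M') = ((x, c) \in M)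
     & forall x c, c \notin B -> ((x, c) \in M') = ((x, c) \in M)].
Proof.
elim: p => [|z p IH] y M MM yM; rewrite [path _ _ _]/=.
  by move=> _ _; exists M; split=> //; split=> //; rewrite /= setU1K.
case/andP=> /stepP[d [dB yd zd]] zp /andP[yzp uzp].
have zy : z != y by apply: contraNneq yzp => ->; rewrite mem_head.
pose M1 := (y, d) |: (M :\ (z, d)).
have MD : matching Ms (M :\ (z, d)) by apply: matching_subl MM (subsetDl _ _).
have cD : d \notin cod (M :\ (z, d)) by rewrite (cod_del MM zd) !inE eqxx.
have yD : y \notin dom (M :\ (z, d)).
  by rewrite (dom_del MM zd) inE negb_and yM orbT.
have MM1 : matching Ms M1 by apply: matching_add.
have zM1 : z \notin dom M1.
  by rewrite dom_add (dom_del MM zd) !inE eqxx (negPf zy).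
have M1E x c : x != y -> x != z -> ((x, c) \in M1) = ((x, c) \in M).
  by move=> xy xz; rewrite !inE !xpair_eqE (negPf xy) (negPf xz).
have zp1 : path (step Ms M1 B) z p.
  apply/(pathP z) => i ip; have /stepP[d' [d'B xd' x'd']] := pathP z zp i ip.
  apply/stepP; exists d'; split=> //.
  have x'p : nth z p i \in p by rewrite mem_nth.
  rewrite M1E //; first by apply: contraNneq yzp => <-; rewrite inE x'p orbT.
  by apply: contraTneq uzp => E; rewrite /= -{1}E x'p.
have [M' [MM' [cE dE off nB]]] := IH z M1 MM1 zM1 zp1 uzp.
have yd' : (y, d) \in M' by rewrite off // !inE eqxx.
exists M'; split=> //; split.
- by rewrite cE cod_add (cod_del MM zd) setD1K //; apply/codP; exists z.
- rewrite dE dom_add (dom_del MM zd) /=; congr (_ :\ _).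
  rewrite setUCA setD1K //; apply/domP; by exists d.
- move=> x c; rewrite inE negb_or => /andP[xy xzp]; rewrite off // M1E //.
  by apply: contraNneq xzp => ->; rewrite mem_head.
- move=> x c cB; rewrite nB // !inE !xpair_eqE.
  have -> : (c == d) = false by apply: contraNF cB => /eqP ->.
  by rewrite !andbF.
Qed.

Definition flexible Ms M := [set x |
  [exists z, connect (step Ms M setT) x z && [exists c, ((z, c) \in Ms) && (c \notin cod M)]]].

Lemma flexibleP Ms M x :
  reflect (exists p, path (step Ms M setT) x p /\
             exists c, (last x p, c) \in Ms /\ c \notin cod M)
          (x \in flexible Ms M).
Proof.
rewrite inE; apply: (iffP existsP) => [[z /andP[/connectP[p pp ->] /existsP[c /andP[? ?]]]]|].
  by exists p; split=> //; exists c.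
case=> p [pp [c [zc cM]]]; exists (last x p); apply/andP; split.
  by apply/connectP; exists p.
by apply/existsP; exists c; rewrite zc.
Qed.

Lemma step_subB Ms M B : subrel (step Ms M B) (step Ms M setT).
Proof. by move=> x y /stepP[d [_ xd yd]]; apply/stepP; exists d. Qed.

Lemma flexible_connect Ms M x y : connect (step Ms M setT) x y ->
  y \in flexible Ms M -> x \in flexible Ms M.
Proof.
move=> xy; rewrite !inE => /existsP[z /andP[yz zc]]; apply/existsP; exists z.
by rewrite zc (connect_trans xy yz).
Qed.

Lemma flexible_path Ms M B x p z : path (step Ms M B) x p -> z \in x :: p ->
  z \in flexible Ms M -> x \in flexible Ms M.
Proof.
move=> /(sub_path (@step_subB Ms M B)) xp; rewrite inE => /orP[/eqP ->//|zp].
apply: flexible_connect; apply/connectP.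
by case/path.splitP: zp xp => p1 p2; rewrite cat_path => /andP[xp1 _];
  exists (rcons p1 z); rewrite ?last_rcons.
Qed.

Lemma augment Ms M y : matching Ms M -> y \notin dom M -> y \in flexible Ms M ->
  exists M', matching Ms M' /\ dom M' = y |: dom M.
Proof.
move=> MM yM /flexibleP[p [yp [c [zc cM]]]].
case/shortenP: yp zc => p' yp' up' _ zc.
have [M' [MM' [cE dE _ _]]] := shift MM yM yp' up'.
exists ((last y p', c) |: M'); split.
  by apply: matching_add; rewrite // ?cE // dE !inE eqxx.
rewrite dom_add dE setD1K // inE.
case/lastP: p' yp' {up' zc cE dE M' MM'} => [|p' z] yp'; first by rewrite inE eqxx.
rewrite last_rcons; apply/orP; right; apply/domP.
have [|d [_ zd]] := path_step_dom yp' (x := z); first by rewrite mem_rcons mem_head.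
by exists d.
Qed.

Lemma flexible_mono Ms M Ms' M' (T : {set V}) :
  [disjoint T & flexible Ms M] ->
  (forall x c, x \notin T -> (x, c) \in Ms -> (x, c) \in Ms') ->
  (forall x c, x \notin T -> (x, c) \in M -> (x, c) \in M') ->
  cod M' \subset cod M ->
  flexible Ms M \subset flexible Ms' M'.
Proof.
move=> dT sMs sM /subsetP sc; apply/subsetP => x /flexibleP[p [xp [c [zc cM]]]].
have nT z : z \in flexible Ms M -> z \notin T.
  by move=> zf; rewrite (disjointFl dT).
elim: p x xp zc => [|y p IH] x /=.
  move=> _ xc; have xT : x \notin T by apply/nT/flexibleP; exists [::]; split=> //; exists c.
  by apply/flexibleP; exists [::]; split=> //; exists c; split;
    [apply: sMs|apply: contra cM => /sc].
case/andP=> xy yp zc; have yf := IH _ yp zc.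
have yT : y \notin T by apply/nT/flexibleP; exists p; split=> //; exists c.
have xT : x \notin T.
  apply/nT/flexibleP; exists (y :: p); split; first by rewrite /= xy.
  by exists c.
case/stepP: xy => d [_ xd yd]; apply: flexible_connect yf; apply: connect1.
by apply/stepP; exists d; split; rewrite ?inE ?sMs ?sM.
Qed.

End Alternating.

(** * Three vertices missing a common colour *)

Section Fork.
Variables V C : finType.
Variables (Ms M : {set V * C}) (N X : {set V}) (y0 : V).
Hypotheses (MM : matching Ms M) (XM : X \subset dom M) (MN : dom M \subset N)
  (y0N : y0 \in N) (y0M : y0 \notin dom M) (y0F : y0 \notin flexible Ms M)
  (slots : forall y, y \in N -> y \notin X ->
     2 + #|X| <= #|[set c | (y, c) \in Ms]|).

(** The colours not held by [X]. An alternating path with colours in [B] that starts at an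
    unsaturated vertex avoids [X], so shifting along it keeps [X] saturated. *)
Let B := [set c | [forall x in X, (x, c) \notin M]].

Lemma card_reserved : #|~: B| <= #|X|.
Proof.
pose h x : option C := [pick c | (x, c) \in M].
have sub : Some @: (~: B) \subset h @: X.
  apply/subsetP => _ /imsetP[c cB ->]; move: cB; rewrite !inE negb_forall.
  case/existsP=> x; rewrite negb_imply negbK => /andP[xX xc].
  apply/imsetP; exists x => //; rewrite /h; case: pickP => [d xd|/(_ c)].
    by case: MM => _ Mf _; rewrite (Mf _ _ _ xd xc).
  by rewrite xc.
rewrite -(card_imset (mem (~: B)) Some_inj).
exact: leq_trans (subset_leq_card sub) (leq_imset_card _ _).
Qed.

(** Among 2 + |X| missing colours, at most |X| are held by [X] and at most one by x itself. *)
Lemma free_slot x : x \in N -> x \notin X ->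
  exists c, [/\ c \in B, (x, c) \in Ms & (x, c) \notin M].
Proof.
move=> xN xX; have := slots xN xX.
have cM : #|[set c | (x, c) \in M]| <= 1.
  apply/card_le1_eqP => c d; rewrite !inE => xc xd.
  by case: MM => _ Mf _; rewrite (Mf _ _ _ xc xd).
have cU : #|~: B :|: [set c | (x, c) \in M]| < 2 + #|X|.
  rewrite ltnS cardsU; apply: leq_trans (leq_subr _ _) _.
  by rewrite addnC; apply: leq_add cM card_reserved.
move=> /(leq_trans cU) lt.
have /subsetPn[c] : ~~ ([set c | (x, c) \in Ms] \subset ~: B :|: [set c | (x, c) \in M]).
  by apply: contraTN lt => /subset_leq_card; rewrite -leqNgt.
rewrite in_set => xc; rewrite in_setU negb_or in_setC negbK in_set => /andP[cB xcM].
by exists c.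
Qed.

(** The last vertex x of a path from [y0] has a free slot of colour a. That colour is used, by some
    x' say. If x' is off the path, the path grows; otherwise shifting up to x' makes x' unsaturated,
    hands a to the predecessor w of x', and leaves the rest of the path running from x' to x. *)
Lemma fork : exists M' y p w a,
  [/\ matching Ms M', cod M' = cod M, dom M' = (y0 |: dom M) :\ y,
      flexible Ms M \subset flexible Ms M'
    & [/\ path (step Ms M' [set~ a]) y p, uniq (y :: p),
          last y p != y, (w, a) \in M'
        & [/\ (y, a) \in Ms, (last y p, a) \in Ms
            & forall x, x \in y :: p -> x \in N /\ x \notin X]]].
Proof.
have [_ Mf Mi] := MM; have [/subsetP MMs _ _] := MM.
suff H n p : path (step Ms M B) y0 p -> uniq (y0 :: p) -> #|V| - size p <= n ->
  exists M' y p w a,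
  [/\ matching Ms M', cod M' = cod M, dom M' = (y0 |: dom M) :\ y,
      flexible Ms M \subset flexible Ms M'
    & [/\ path (step Ms M' [set~ a]) y p, uniq (y :: p),
          last y p != y, (w, a) \in M'
        & [/\ (y, a) \in Ms, (last y p, a) \in Ms
            & forall x, x \in y :: p -> x \in N /\ x \notin X]]].
  exact: (H #|V| [::] isT isT (leq_subr _ _)).
elim: n p => [|n IH] p y0p up szp.
  have lt : size p < #|V| by rewrite -[_.+1]/(size (y0 :: p)) -(card_uniqP up) max_card.
  by rewrite leqn0 subn_eq0 leqNgt lt in szp.
have good x : x \in y0 :: p -> x \in N /\ x \notin X.
  rewrite inE => /orP[/eqP -> |xp].
    by split=> //; apply: contra y0M; apply/subsetP.
  have [d [dB xd]] := path_step_dom y0p xp; split.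
    by apply: (subsetP MN); apply/domP; exists d.
  by apply: contraTN xd => xX; move: dB; rewrite inE => /forallP/(_ x); rewrite xX.
set x := last y0 p; have xp : x \in y0 :: p by apply: mem_last.
have [xN xX] := good x xp.
have [a [aB xa xaM]] := free_slot xN xX.
have /codP[x' x'a] : a \in cod M.
  apply: contraNT y0F => aM; apply: (flexible_path y0p xp).
  by apply/flexibleP; exists [::]; split=> //; exists a.
have x'x : x' != x by apply: contraNneq xaM => <-.
have y0x' : y0 != x' by apply: contraNneq y0M => ->; apply/domP; exists a.
have [x'p|x'p] := boolP (x' \in y0 :: p); last first.
  apply: (IH (rcons p x')).
  - by rewrite rcons_path y0p; apply/stepP; exists a.
  - by rewrite -rcons_cons rcons_uniq x'p up.
  - by rewrite size_rcons subnS -ltnS (leq_trans _ szp) // ltn_predL subn_gt0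
         -[_.+1]/(size (y0 :: p)) -(card_uniqP up) max_card.
move: x'p; rewrite inE eq_sym (negPf y0x') /= => x'p.
move: y0p up good x'x xa; clear szp xp xN xX xaM; rewrite {}/x.
case/path.splitP: x'p => p1 p2; rewrite last_cat last_rcons cat_path last_rcons.
case/andP=> yp1 x'p2 up good lx xa.
have [up1 dis up2] : [/\ uniq (y0 :: rcons p1 x'),
    forall u, u \in p2 -> u \notin y0 :: rcons p1 x' & uniq (x' :: p2)].
  move: up; rewrite -cat_cons cat_uniq => /and3P[u1 /hasPn u2 u3]; split=> //.
  rewrite /= u3 andbT; apply: contraTN (u1) => /u2 /=.
  by rewrite inE mem_rcons mem_head orbT.
have [M' [MM' [cE dE off _]]] := shift MM y0M yp1 up1.
have /codP[w wa] : a \in cod M' by rewrite cE; apply/codP; exists x'.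
exists M', x', p2, w, a; split=> //; first by rewrite dE last_rcons.
- apply: (@flexible_mono _ _ _ _ _ _ [set u in y0 :: rcons p1 x']) => //.
  + rewrite disjoint_subset; apply/subsetP => u; rewrite inE => up'.
    by rewrite inE; apply: contra y0F; apply: flexible_path yp1 up'.
  + by move=> u c; rewrite inE => uT uc; rewrite off.
  + by rewrite cE.
split=> //.
(* The remaining path avoids colour a, since a was matched to x' alone and x' does not recur. *)
- apply/(pathP x') => i ip; have /stepP[d [dB ud u'd]] := pathP x' x'p2 i ip.
  have u'p := mem_nth x' ip.
  apply/stepP; exists d; split=> //; last by rewrite off ?dis.
  rewrite !inE; apply: contraNneq (dis _ u'p) => E.
  by rewrite E in u'd; rewrite (Mi _ _ _ u'd x'a) inE mem_rcons mem_head orbT.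
- by rewrite eq_sym.
- split=> //; first by apply: MMs.
  move=> u; rewrite inE => /orP[/eqP ->|up2']; apply: good.
    by rewrite inE mem_cat mem_rcons mem_head orbT.
  by rewrite inE mem_cat up2' !orbT.
Qed.

End Fork.

(** * Adding a vertex *)

Section SwapColors.
Variables (l : nat) (a b : color l).

(** The tests on [a] and [b] come first, so that for [b = opp_color a] this is the transposition of
    the two. *)
Definition swap_colors c :=
  if c == a then b else if c == b then a
  else if c == opp_color a then opp_color b
  else if c == opp_color b then opp_color a else c.

Lemma opp_color_eq (c d : color l) : (opp_color c == opp_color d) = (c == d).
Proof. exact: inj_eq (inv_inj (@opp_colorK l)) c d. Qed.

Lemma opp_color_eqC (c d : color l) : (opp_color c == d) = (c == opp_color d).
Proof. by rewrite -opp_color_eq opp_colorK. Qed.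

Lemma swap_colors_a : swap_colors a = b.
Proof. by rewrite /swap_colors eqxx. Qed.

Lemma swap_colorsK : involutive swap_colors.
Proof.
move=> c; rewrite {2}/swap_colors.
have [-> | ca] := eqVneq c a; first by rewrite /swap_colors eqxx; case: eqVneq.
have [-> | cb] := eqVneq c b; first by rewrite /swap_colors eqxx.
have [E | coa] := eqVneq c (opp_color a).
  have N1 : (opp_color b == a) = false by rewrite opp_color_eqC eq_sym -E (negPf cb).
  rewrite /swap_colors N1 opp_color_neq opp_color_eq E eqxx.
  by case: eqVneq => // ->.
have [E | cob] := eqVneq c (opp_color b).
  have N1 : (opp_color a == b) = false by rewrite opp_color_eqC eq_sym -E (negPf ca).
  by rewrite /swap_colors opp_color_neq N1 E eqxx.
by rewrite /swap_colors (negPf ca) (negPf cb) (negPf coa) (negPf cob).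
Qed.

Lemma swap_colorsN : {morph swap_colors : c / opp_color c}.
Proof.
move=> c; rewrite /swap_colors !opp_color_eqC !opp_colorK.
have [Eca|nca] := eqVneq c a.
  rewrite Eca [a == opp_color a]eq_sym opp_color_neq.
  by case: eqVneq => // Eab; rewrite {2}Eab opp_colorK.
have [Ecb|ncb] := eqVneq c b.
  rewrite Ecb [b == opp_color b]eq_sym opp_color_neq.
  by case: eqVneq => // Eba; rewrite Eba.
by case: ifP => _; [|case: ifP => _]; rewrite ?opp_colorK.
Qed.

Lemma swap_colors_moved c : swap_colors c != c ->
  [\/ c = a, c = b | c \in [set opp_color a; opp_color b]].
Proof.
rewrite /swap_colors; have [->|_] := eqVneq c a; first by constructor 1.
have [->|_] := eqVneq c b; first by constructor 2.
by move=> H; constructor 3; move: H; rewrite !inE; do 2![case: ifP => //]; rewrite eqxx.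
Qed.

End SwapColors.

(** * Saturating the neighbourhood of the new vertex *)

Section Extend.
Variables (V : finType) (l : nat) (sg : V -> V -> bool) (e : rel V).
Hypothesis eC : symmetric e.
Variables (N X : {set V}).
Hypotheses (Nl : #|N| <= l.*2)
  (slots : forall y, y \in N -> y \notin X -> deg e y + 2 + #|X| <= l.*2).

Let state (f : V -> V -> color l) (M : {set V * color l}) :=
  [/\ proper sg e f, matching (missing e f) M, X \subset dom M & dom M \subset N].

(** Lexicographic progress: a larger matching, or one of equal size with more flexible vertices. *)
Let better (f : V -> V -> color l) (M : {set V * color l}) := exists f' M', state f' M' /\
  (#|M| < #|M'| \/
   #|M| = #|M'| /\ #|flexible (missing e f) M| < #|flexible (missing e f') M'|).

Lemma improve_fork (f : V -> V -> color l) (M : {set V * color l}) y p w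
    (a : color l) (Ms := missing e f) (z := last y p) :
  state f M -> #|M| < #|N| -> y \notin dom M -> y \in N -> y \notin flexible Ms M ->
  path (step Ms M [set~ a]) y p -> uniq (y :: p) -> z != y -> (w, a) \in M ->
  (y, a) \in Ms -> (z, a) \in Ms ->
  (forall x, x \in y :: p -> x \in N /\ x \notin X) -> better f M.
Proof.
case=> fP MM XM MN MltN yM yN yF yp up zy wa ya za good.
have [MMs Mf Mi] := MM; move/subsetP: MMs => MMs.
have yz q : q \in [:: y; z] -> q \in y :: p.
  by rewrite !inE => /orP[->//|/eqP ->]; rewrite -in_cons mem_last.
have Mcard : #|cod M| = #|M| := card_cod MM.
have [b bM] : exists b, b \notin cod M.
  have /subsetPn[b _ bM] : ~~ ([set: color l] \subset cod M).
    apply: contraL MltN => /subset_leq_card; rewrite cardsT Mcard -leqNgt.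
    by rewrite card_prod card_ord card_bool muln2; apply: leq_trans.
  by exists b.
have ab : a != b by apply: contraNneq bM => <-; apply/codP; exists w.
have qaM q : q \in [:: y; z] -> (q, a) \notin M.
  rewrite !inE => /orP[/eqP ->|/eqP ->].
    by apply: contra yM => H; apply/domP; exists a.
  have zp : z \in p by have := mem_last y p; rewrite inE (negPf zy).
  have [d [da zd]] := path_step_dom yp zp.
  by move: da; rewrite !inE; apply: contraNN => za'; rewrite (Mf _ _ _ zd za').
have wMs : (w, a) \in Ms by apply: MMs.
have yX x : x \in y :: p -> x \notin X by case/good.
have gain (f' : V -> V -> color l) (M' : {set V * color l}) :
    proper sg e f' -> matching (missing e f') M' ->
    dom M' = y |: dom M -> better f M.
  move=> f'P MM' dE; exists f', M'; split.
    split=> //; rewrite dE; first by apply: subset_trans XM (subsetUr _ _).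
    by rewrite subUset sub1set yN.
  by left; rewrite -(card_dom MM') -(card_dom MM) dE cardsU1 yM.
(* Shifting along the path up to x makes x the unsaturated vertex instead of y; slots of colour a
   are untouched because the path avoids a. *)
have reroot x : x \in y :: p -> exists M', matching Ms M' /\
    [/\ cod M' = cod M, x \notin dom M', x |: dom M' = y |: dom M,
        forall u c, u \notin y :: p -> ((u, c) \in M') = ((u, c) \in M)
      & forall u, ((u, a) \in M') = ((u, a) \in M)].
  move=> xp; have [p1 [p2 [Ep lx]]] : exists p1 p2, p = p1 ++ p2 /\ last y p1 = x.
    by case/splitPl: xp => p1 p2 <-; exists p1, p2.
  have yp1 : path (step Ms M [set~ a]) y p1 by move: yp; rewrite Ep cat_path => /andP[].
  have up1 : uniq (y :: p1) by move: up; rewrite Ep -cat_cons cat_uniq => /andP[].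
  have [M' [MM' [cE dE off nB]]] := shift MM yM yp1 up1.
  exists M'; split=> //; split=> //.
  - by rewrite dE lx !inE eqxx.
  - rewrite dE lx setD1K // !inE; move: (mem_last y p1); rewrite lx inE.
    case/orP=> [->//|xp1]; have [d [_ xd]] := path_step_dom yp1 xp1.
    by apply/orP; right; apply/domP; exists d.
  - move=> u c; rewrite Ep -cat_cons mem_cat negb_or => /andP[uy _]; exact: off.
  - by move=> u; apply: nB; rewrite !inE negbK.
have nflex x : x \in y :: p -> x \notin flexible Ms M.
  by move=> xp; apply: contra yF; apply: flexible_path yp xp.
pose th := @swap_colors l a b.
have [pi [piM piK piS]] := kempe_pairing eC fP (@swap_colorsK l a b) (@swap_colorsN l a b).
pose bad := [set m in M :\ (w, a) | m.2 \in [set opp_color a; opp_color b]].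
have moved m : m \in M -> m != (w, a) -> th m.2 != m.2 -> m \in bad.
  move=> mM mw /swap_colors_moved; case: m mM mw => u c uc uw /= [E|E|E].
  - by rewrite E in uc uw; rewrite (Mi _ _ _ uc wa) eqxx in uw.
  - by case/codP: bM; exists u; rewrite -E.
  - by rewrite !inE uw uc; move: E; rewrite !inE.
(* A matching survives the swap of a chain if it uses neither end, or uses only the second one and
   the swap fixes its colour. *)
have swM (f' : V -> V -> color l) x (M' : {set V * color l}) :
    (forall m, m \in Ms -> m != x -> m != pi x -> m \in missing e f') ->
    switch th (pi x) \in missing e f' -> matching Ms M' -> x \notin M' ->
    (pi x \notin M' \/ th (pi x).2 = (pi x).2) -> matching (missing e f') M'.
  move=> sub s2 MM' xM pM; apply: (matching_sub MM') => m mM'.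
  have [E|mpi] := eqVneq m (pi x).
    case: pM => [|E2]; first by rewrite -E mM'.
    by rewrite E; move: s2; rewrite /switch E2 -surjective_pairing.
  apply: sub => //; last by apply: contraNneq xM => <-.
  by case: MM' => /subsetP H _ _; apply: H.
(* If w has gained b while q still misses a, then w moves from a to b and q takes a. *)
have gainW (f' : V -> V -> color l) q (M' : {set V * color l}) :
    proper sg e f' -> q \in [:: y; z] -> matching Ms M' ->
    cod M' = cod M -> q \notin dom M' -> q |: dom M' = y |: dom M -> (w, a) \in M' ->
    matching (missing e f') (M' :\ (w, a)) ->
    (q, a) \in missing e f' -> (w, b) \in missing e f' -> better f M.
  move=> f'P qyz MM' cE qM' dE wM' MD qa wb.
  have wd : w \in dom M' by apply/domP; exists a.
  have wq : w != q by apply: contraTneq wd => ->.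
  apply: (gain f' ((w, b) |: ((q, a) |: (M' :\ (w, a))))) => //.
    apply: matching_add => //; first apply: matching_add => //.
    + by rewrite (dom_del MM' wM') inE negb_and qM' orbT.
    + by rewrite (cod_del MM' wM') !inE eqxx.
    + by rewrite dom_add (dom_del MM' wM') !inE eqxx (negPf wq).
    + by rewrite cod_add (cod_del MM' wM') !inE cE (negPf bM) andbF orbF eq_sym.
  by rewrite !dom_add (dom_del MM' wM') setUCA setD1K // dE.
have chain q : q \in [:: y; z] -> better f M \/ pi (q, a) \in bad.
  move=> qyz; have qp := yz q qyz.
  have qa : (q, a) \in Ms by move: qyz; rewrite mem_seq2 => /orP[]/eqP->.
  have [f' [f'P [sub s1 s2]]] := piS _ qa.
  have qb : (q, b) \in missing e f' by move: s1; rewrite /switch /= swap_colors_a.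
  set m := pi (q, a) in sub s2 *.
  have [xp|xp] := boolP (m.1 \in y :: p).
    (* Rerooted at the chain's end on the path, the matching avoids both swapped
       slots, and q has gained the unused colour b. *)
    left; have [M' [MM' [cE xM' dE off aE]]] := reroot _ xp.
    have mM' : m \notin M' by
      apply: contra xM' => H; apply/domP; exists m.2; rewrite -surjective_pairing.
    have MM'' : matching (missing e f') M'.
      by apply: swM sub s2 MM' _ _; [rewrite aE qaM | left].
    have [Eq|qx] := eqVneq q m.1.
      apply: (gain f' ((q, b) |: M')) => //.
        by apply: matching_add => //; rewrite ?cE // Eq.
      by rewrite dom_add Eq dE.
    exists f', M'; split.
      split=> //.
        apply/subsetP => u uX; have : u \in m.1 |: dom M'.
          by rewrite dE inE (subsetP XM) ?orbT.
        rewrite in_setU1 => /orP[/eqP Eu|//].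
        by move: uX; rewrite Eu (negPf (yX _ xp)).
      apply: subset_trans (subsetUr [set m.1] _) _; rewrite dE.
      by rewrite subUset sub1set yN.
    right; split; first by rewrite -Mcard -cE (card_cod MM').
    apply: proper_card; apply/properP; split.
      apply: (@flexible_mono _ _ _ _ _ _ [set u in y :: p]).
      - rewrite disjoint_subset; apply/subsetP => u; rewrite in_set => up'.
        by rewrite inE /=; apply: nflex.
      - move=> u c; rewrite inE => up' uc; apply: sub => //.
          by apply: contraNneq up' => -[-> _].
        by apply: contraNneq up' => E; rewrite -E in xp.
      - by move=> u c; rewrite inE => up' uc; rewrite off.
      - by rewrite cE.
    exists q; last exact: nflex.
    by apply/flexibleP; exists [::]; split=> //; exists b; rewrite cE.
  (* An unmatched far end does no harm: q is made the unsaturated vertex and takes b. *)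
  have [mM|mM] := boolP (m \in M); last first.
    left; have [M' [MM' [cE qM' dE off aE]]] := reroot _ qp.
    apply: (gain f' ((q, b) |: M')) => //; last by rewrite dom_add dE.
    apply: matching_add; rewrite ?cE //; apply: swM sub s2 MM' _ _.
      by rewrite aE qaM.
    by left; rewrite -/m; move: mM; rewrite (surjective_pairing m) off.
  have [Em|mw] := eqVneq m (w, a); last first.
    have [E|/(moved _ mM mw)] := eqVneq (th m.2) m.2; last by right.
    left; have [M' [MM' [cE qM' dE off aE]]] := reroot _ qp.
    apply: (gain f' ((q, b) |: M')) => //; last by rewrite dom_add dE.
    apply: matching_add; rewrite ?cE //; apply: swM sub s2 MM' _ _.
      by rewrite aE qaM.
    by right.
  (* The chain joins (q, a) to (w, a), so w gains b; the other one of y and z still misses a and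
     takes it over from w. *)
  left; have [q' q'yz q'q] : exists2 q', q' \in [:: y; z] & q' != q.
    move: qyz; rewrite !inE => /orP[]/eqP ->; [exists z|exists y] => //.
    - by rewrite !inE eqxx orbT.
    - by rewrite !inE eqxx.
    - by rewrite eq_sym.
  have [M' [MM' [cE qM' dE off aE]]] := reroot _ (yz _ q'yz).
  apply: (gainW f' q' M') => //.
  - by rewrite aE.
  - apply: swM sub s2 (matching_subl MM' (subsetDl _ _)) _ _.
      by rewrite inE aE (negPf (qaM _ qyz)) andbF.
    by left; rewrite -/m Em !inE eqxx.
  - apply: sub.
    + by move: q'yz; rewrite mem_seq2 => /orP[]/eqP->.
    + by rewrite xpair_eqE (negPf q'q).
    + by rewrite Em; apply: contraNneq (qaM _ q'yz) => ->.
  - by move: s2; rewrite Em /switch /= swap_colors_a.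
have [//|bady] : better f M \/ pi (y, a) \in bad by apply: chain; rewrite !inE eqxx.
have [//|badz] : better f M \/ pi (z, a) \in bad by apply: chain; rewrite !inE eqxx orbT.
have wbad : (w, a) \notin bad by rewrite !inE eqxx.
have [//|badw] : better f M \/ pi (w, a) \in bad.
  have [f' [f'P [sub s1 s2]]] := piS _ wMs.
  have wb : (w, b) \in missing e f' by move: s1; rewrite /switch /= swap_colors_a.
  set m := pi (w, a) in sub s2 *.
  (* The chains from y and z end in [bad], which does not contain (w, a), so the chain from w ends
     at neither (y, a) nor (z, a). *)
  have mq q : q \in [:: y; z] -> (q, a) != m.
    move=> qyz; apply: contraNneq wbad => E; rewrite -(piK _ wMs) -/m -E.
    by move: qyz; rewrite mem_seq2 => /orP[]/eqP->.
  have wq q : q \in [:: y; z] -> (q, a) != (w, a).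
    by move=> qyz; apply: contraNneq (qaM _ qyz) => ->.
  have qaf q : q \in [:: y; z] -> (q, a) \in missing e f'.
    move=> qyz; apply: sub; [|exact: wq|exact: mq].
    by move: qyz; rewrite mem_seq2 => /orP[]/eqP->.
  have yy : y \in [:: y; z] by rewrite !inE eqxx.
  have wD (M' : {set V * color l}) : (w, a) \notin M' :\ (w, a) by rewrite !inE eqxx.
  have useM : m \notin M :\ (w, a) \/ th m.2 = m.2 -> better f M.
    move=> H; apply: (gainW f' y M) => //; last exact: qaf.
    exact: swM sub s2 (matching_subl MM (subsetDl _ _)) (wD _) H.
  have [mM|mM] := boolP (m \in M :\ (w, a)); last by left; apply: useM; left.
  have [E|mth] := eqVneq (th m.2) m.2; first by left; apply: useM; right.
  by right; move: mM; rewrite in_setD1 => /andP[mw mM]; apply: moved.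
have card_bad : #|bad| <= 2.
  rewrite -(card_in_imset (f := snd)).
    apply: leq_trans (_ : #|[set opp_color a; opp_color b]| <= 2);
      last by rewrite cards2; case: eqP.
    by apply: subset_leq_card; apply/subsetP => _ /imsetP[m + ->]; rewrite inE => /andP[].
  move=> [u c] [u' c']; rewrite !inE => /andP[/andP[_ uc] _] /andP[/andP[_ uc'] _] /= E.
  by rewrite -E in uc' *; rewrite (Mi _ _ _ uc uc').
have pi_inj x x' : x \in Ms -> x' \in Ms -> x != x' -> pi x != pi x'.
  by move=> xMs x'Ms; apply: contra_neq => E; rewrite -(piK _ xMs) E piK.
have wy : (w, a) != (y, a) by apply: contraTneq wa => ->; apply: qaM; rewrite !inE eqxx.
have wz : (w, a) != (z, a) by apply: contraTneq wa => ->; apply: qaM; rewrite !inE eqxx orbT.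
have zya : (z, a) != (y, a) by rewrite xpair_eqE (negPf zy).
(* [pi] is injective on missing slots, so three distinct starts would give three elements of a set
   of size at most two. *)
have u3 : uniq [:: pi (w, a); pi (z, a); pi (y, a)].
  by rewrite /= !inE negb_or !pi_inj.
have : size [:: pi (w, a); pi (z, a); pi (y, a)] <= #|bad|.
  rewrite -(card_uniqP u3); apply: subset_leq_card; apply/subsetP => x.
  by rewrite !inE => /or3P[]/eqP->; [move: badw|move: badz|move: bady]; rewrite !inE.
by rewrite /= => /leq_trans /(_ card_bad).
Qed.

Lemma improve (f : V -> V -> color l) (M : {set V * color l}) :
  state f M -> dom M != N -> better f M.
Proof.
move=> st dN; have [fP MM XM MN] := st.
have dN' : dom M \proper N by rewrite properEneq dN.
have MltN : #|M| < #|N| by rewrite -(card_dom MM) proper_card.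
have card_better (M' : {set V * color l}) y : matching (missing e f) M' -> y \in N ->
    y \notin dom M -> dom M' = y |: dom M -> better f M.
  move=> MM' yN yM dE; exists f, M'; split.
    split=> //; rewrite dE; first exact: subset_trans XM (subsetUr _ _).
    by rewrite subUset sub1set yN.
  by left; rewrite -(card_dom MM') -(card_dom MM) dE cardsU1 yM.
have [_ [y0 y0N y0M]] := properP dN'.
have [y0F|y0F] := boolP (y0 \in flexible (missing e f) M).
  by have [M' [MM' dE]] := augment MM y0M y0F; apply: card_better dE.
have slots' y : y \in N -> y \notin X -> 2 + #|X| <= #|[set c | (y, c) \in missing e f]|.
  by move=> yN yX; have := slots yN yX; have := card_missing e f y; lia.
have [M' [y [p [w [a [MM' cE dE sF [yp up zy wa [ya za good]]]]]]]] :=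
  fork MM XM MN y0N y0M y0F slots'.
have [yN yX] := good y (mem_head _ _).
have cM : #|M'| = #|M| by rewrite -(card_cod MM) -(card_cod MM') cE.
have yM : y \notin dom M' by rewrite dE !inE eqxx.
have st' : state f M'.
  split=> //; rewrite dE.
    by rewrite subsetD1 yX (subset_trans XM) // subsetUr.
  by rewrite subDset subUset sub1set inE y0N orbT (subset_trans MN) ?subsetUr.
have bM : better f M' -> better f M.
  case=> f' [M'' [st'' lt]]; exists f', M''; split=> //; rewrite -cM.
  case: lt => [|[E lt]]; [by left|right; split=> //].
  exact: leq_ltn_trans (subset_leq_card sF) lt.
apply: bM; have [yF|yF] := boolP (y \in flexible (missing e f) M').
  have [M'' [MM'' dE'']] := augment MM' yM yF; have [_ _ XM' MN'] := st'.
  exists f, M''; split.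
    split=> //; rewrite dE''; first exact: subset_trans XM' (subsetUr _ _).
    by rewrite subUset sub1set yN.
  by left; rewrite -(card_dom MM'') -(card_dom MM') dE'' cardsU1 yM.
by apply: improve_fork yp up zy wa ya za good => //; rewrite cM.
Qed.

Lemma saturate (f : V -> V -> color l) (M : {set V * color l}) :
  state f M -> exists f' M', state f' M' /\ dom M' = N.
Proof.
(* The lexicographic order of [better] as one number: the second summand is at most |V|, hence the
   weight |V| + 1 on the first. *)
pose mu (f' : V -> V -> color l) (M' : {set V * color l}) :=
  (#|N| - #|M'|) * #|V|.+1 + (#|V| - #|flexible (missing e f') M'|).
have [n] := ubnP (mu f M); elim: n f M => // n IH f M lt st.
have [dN|dN] := eqVneq (dom M) N; first by exists f, M.
have [f' [M' [st' imp]]] := improve st dN.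
apply: (IH f' M') => //; rewrite ltnS in lt; apply: leq_trans lt.
have bd (f1 : V -> V -> color l) (M1 : {set V * color l}) : state f1 M1 ->
    #|M1| <= #|N| /\ #|flexible (missing e f1) M1| <= #|V|.
  case=> _ MM1 _ sN; rewrite -(card_dom MM1) subset_leq_card //.
  by split=> //; apply: max_card.
have := bd _ _ st; have := bd _ _ st'; rewrite /mu.
move: #|flexible _ _| #|flexible _ _| imp => F' F; nia.
Qed.
End Extend.

(** * Switching and the colouring of a star *)

Section AddVertex.
Variables (V : finType) (l : nat).

Definition colorable (sg : V -> V -> bool) (e : rel V) :=
  exists f : V -> V -> color l, proper sg e f.

Lemma colorable_switch sg (t : V -> bool) e :
  colorable (fun u w => sg u w (+) t u (+) t w) e -> colorable sg e.
Proof.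
case=> f [fE fI]; exists (fun u w => twist (t u) (f u w)); split.
  move=> u w euw; rewrite fE // -!twist_addb; congr (twist _ _).
  by case: (sg u w) (t u) (t w) => [] [] [].
by move=> u w w' euw euw' /(inv_inj (@twistK l _)); apply: fI.
Qed.

Definition add_star (e : rel V) v (N : {set V}) : rel V := fun u w =>
  [|| e u w, (u == v) && (w \in N) | (w == v) && (u \in N)].

Lemma add_vertex sg e v (N X : {set V}) :
  symmetric e -> (forall w, ~~ e v w) -> (forall u w, sg u w = sg w u) ->
  v \notin N -> #|N| <= l.*2 -> X \subset N -> #|X| <= 1 ->
  (forall x, x \in X -> deg e x < l.*2) ->
  (forall y, y \in N -> y \notin X -> deg e y + 2 + #|X| <= l.*2) ->
  colorable sg e -> colorable sg (add_star e v N).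
Proof.
move=> eC ev sgC vN Nl XN X1 degX slots cole.
(* Switching at the vertices joined to v with sign [true] makes all edges between v and [N]
   negative. *)
apply: (@colorable_switch _ (fun u => (u != v) && sg v u)).
set sg' := fun u w => _; have {cole} [f0 f0P] : colorable sg' e.
  apply: (@colorable_switch _ (fun u => (u != v) && sg v u)).
  case: cole => f [fE fI]; exists f; split=> // u w euw; rewrite fE //; congr twist.
  by rewrite /sg'; case: (sg u w) (_ && _) (_ && _) => [] [] [].
have sgv w : w \in N -> sg' v w = false.
  move=> wN; have wv : w != v by apply: contraNneq vN => <-.
  by rewrite /sg' eqxx wv addbF addbb.
have sgv' w : w \in N -> sg' w v = false.
  by move=> wN; rewrite -(sgv w wN) /sg' sgC -!addbA (addbC (_ && _)).
(* The initial matching saturates exactly [X], whose only possible element has a missing colour by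
   [degX]. *)
have [M0 M0M M0X] : exists2 M0, matching (missing e f0) M0 & dom M0 = X.
  have [->|[x xX]] := set_0Vmem X.
    exists set0; last by rewrite /dom imset0.
    by split=> [|u c d|u w c]; rewrite ?sub0set ?inE.
  have EX : X = [set x].
    by apply/eqP; rewrite eq_sym eqEcard sub1set xX cards1.
  have [c] : exists c, (x, c) \in missing e f0.
    have := card_missing e f0 x; have := degX x xX.
    case: (set_0Vmem [set c | (x, c) \in missing e f0]) => [->|[c]]; first by rewrite cards0; lia.
    by rewrite inE => xc _ _; exists c.
  exists [set (x, c)]; last by rewrite /dom imset_set1 EX.
  split=> [|u d d'|u w d]; first by rewrite sub1set.
    by rewrite !inE => /eqP[_ ->] /eqP[_ ->].
  by rewrite !inE => /eqP[-> _] /eqP[-> _].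
have [|f [M [[fP [MMs Mf Mi] _ _] dN]]] := @saturate V l sg' e eC N X Nl slots f0 M0.
  by split=> //; rewrite M0X.
pose m u := odflt (f v v) [pick c | (u, c) \in M].
have mM u : u \in N -> (u, m u) \in M.
  rewrite -dN => /domP[c uc]; rewrite /m; case: pickP => [//|/(_ c)].
  by rewrite uc.
have mMs u : u \in N -> (u, m u) \in missing e f by move/mM; apply: (subsetP MMs).
have mI u w : u \in N -> w \in N -> m u = m w -> u = w.
  by move=> /mM uM /mM wM E; rewrite E in uM; apply: Mi uM wM.
have ev' u : e u v = false by rewrite eC (negPf (ev u)).
(* A negative edge has the same colour at both ends. The matched colour is missing at the neighbour,
   and injectivity of the matching keeps the colours at v distinct. *)
exists (fun u w => if u == v then m w else if w == v then m u else f u w).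
split=> [u w|u w w'].
  case/or3P => [euw|/andP[/eqP -> wN]|/andP[/eqP -> uN]].
  - have uv : u != v by apply: contraTneq euw => ->.
    have wv : w != v by apply: contraTneq euw => ->; rewrite ev'.
    by rewrite (negPf uv) (negPf wv); apply: fP.1.
  - by rewrite eqxx sgv //; case: eqP => // E; rewrite E in wN; rewrite wN in vN.
  - by rewrite eqxx sgv' //; case: eqP => // E; rewrite E in uN; rewrite uN in vN.
have [->|uv] := eqVneq u v.
  rewrite /add_star !(negPf (ev _)) eqxx (negPf vN) !andbF !orbF.
  by apply: mI.
rewrite /add_star (negPf uv) /= => /orP[euw|/andP[/eqP -> uN]] /orP[euw'|/andP[/eqP -> uN']] //.
- have wv : w != v by apply: contraTneq euw => ->; rewrite ev'.
  have wv' : w' != v by apply: contraTneq euw' => ->; rewrite ev'.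
  by rewrite (negPf wv) (negPf wv'); apply: fP.2.
- have wv : w != v by apply: contraTneq euw => ->; rewrite ev'.
  rewrite (negPf wv) eqxx => E; have /missingP/(_ w euw) := mMs u uN'.
  by rewrite /= E eqxx.
- have wv' : w' != v by apply: contraTneq euw' => ->; rewrite ev'.
  rewrite (negPf wv') eqxx => E; have /missingP/(_ w' euw') := mMs u uN.
  by rewrite /= E eqxx.
Qed.

End AddVertex.

(** * Building a graph up by induced subgraphs *)

Section Restrict.
Variables (V : finType) (l : nat) (sg : V -> V -> bool) (e : rel V).
Hypotheses (sgC : forall u w, sg u w = sg w u) (eC : symmetric e) (eI : irreflexive e).
Implicit Types A S : {set V}.

Definition restrict A : rel V := fun u w => [&& e u w, u \in A & w \in A].

Lemma eq_colorable (e1 e2 : rel V) : e1 =2 e2 -> colorable l sg e1 -> colorable l sg e2.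
Proof.
move=> E [f [fE fI]]; exists f; split=> [u w|u w w']; rewrite -!E; first exact: fE.
exact: fI.
Qed.

Lemma leq_deg_restrict A S u : A \subset S -> deg (restrict A) u <= deg (restrict S) u.
Proof.
move/subsetP=> AS; apply: subset_leq_card; apply/subsetP => w; rewrite !inE /restrict.
by case/and3P=> -> /AS -> /AS ->.
Qed.

Lemma leq_deg A u : deg (restrict A) u <= deg e u.
Proof. by apply: subset_leq_card; apply/subsetP => w; rewrite !inE => /and3P[]. Qed.

(** [add_vertex] in terms of degrees in the larger graph: a neighbour of v has one more edge there,
    so the 2 in its bound becomes 1. *)
Lemma colorable_del A v (X : {set V}) : v \in A ->
  deg (restrict A) v <= l.*2 ->
  (forall x, x \in X -> restrict A v x /\ deg (restrict A) x <= l.*2) -> #|X| <= 1 ->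
  (forall y, restrict A v y -> y \notin X -> deg (restrict A) y + 1 + #|X| <= l.*2) ->
  colorable l sg (restrict (A :\ v)) -> colorable l sg (restrict A).
Proof.
move=> vA dv dX X1 dN; pose N := [set w | restrict A v w].
have degN y : restrict A v y -> deg (restrict A) y = (deg (restrict (A :\ v)) y).+1.
  case/and3P=> vy _ yA; have yv : y != v by apply: contraTneq vy => ->; rewrite eI.
  rewrite /deg (cardsD1 v) inE /restrict eC vy yA vA /= add1n; congr _.+1.
  apply: eq_card => w; rewrite !inE yv yA /=.
  by case: (w != v); rewrite ?andbF.
move/(@add_vertex _ _ _ _ v N X); move=> H; apply: eq_colorable (H _ _ _ _ _ _ _ _ _) => //.
- move=> u w; rewrite /add_star /restrict !inE /restrict vA /=.
  have [->|uv] := eqVneq u v; have [->|wv] := eqVneq w v; rewrite ?eI /= ?andbF ?orbF ?vA //=.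
  by rewrite (eC v) andbT andbC.
- by move=> u w; rewrite /restrict eC; congr (_ && _); rewrite andbC.
- by move=> w; rewrite /restrict !inE eqxx andbF.
- by rewrite inE /restrict eI.
- by apply/subsetP => x /dX[]; rewrite inE.
- by move=> x /dX[vx]; rewrite degN.
- by move=> y; rewrite inE => vy yX; have := dN y vy yX; rewrite degN //; lia.
Qed.

(** Vertices of degree 2l are pairwise nonadjacent. One of them is deleted first, as all its
    neighbours have smaller degree; when none is left, any vertex can be deleted. *)
Lemma colorable_core S : 0 < l ->
  (forall u, deg (restrict S) u <= l.*2) ->
  (forall u w, restrict S u w -> deg (restrict S) u < l.*2 \/ deg (restrict S) w < l.*2) ->
  forall A, A \subset S -> colorable l sg (restrict A).
Proof.
move=> l0 dS core A; have [n] := ubnP #|A|; elim: n A => // n IH A An AS.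
have step v : v \in A -> deg (restrict A) v <= l.*2 ->
    (forall y, restrict A v y -> deg (restrict A) y < l.*2) -> colorable l sg (restrict A).
  move=> vA dv dN; apply: (@colorable_del _ v set0) => //; rewrite ?cards0 //.
  - by move=> x; rewrite inE.
  - by move=> y vy _; rewrite addn0 addn1; apply: dN.
  apply: IH; last by apply: subset_trans (subsetDl _ _) AS.
  by rewrite -ltnS (leq_trans _ An) // [X in _ < X.+1](cardsD1 v) vA.
have dA u : deg (restrict A) u <= deg (restrict S) u by apply: leq_deg_restrict.
have [/existsP[v /andP[vA /eqP dv]]|no] := boolP [exists v in A, deg (restrict A) v == l.*2].
  apply: (step v) => //; first by rewrite dv.
  move=> y /and3P[vy _ yA]; have : restrict S v y by rewrite /restrict vy !(subsetP AS).
  move/core; by have := dA v; have := dA y; have := dS v; lia.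
have [A0|[v vA]] := set_0Vmem A.
  (* Even the empty graph needs some colour as a function value, which [l0] supplies. *)
  case: l l0 => // l' _; exists (fun _ _ => (ord0, true)).
  by split=> [u w|u w w']; rewrite /restrict A0 !inE !andbF.
have lt u : u \in A -> deg (restrict A) u < l.*2.
  move=> uA; rewrite ltn_neqAle (leq_trans (dA u)) // andbT.
  by move: no; rewrite negb_exists => /forallP/(_ u); rewrite uA.
apply: (step v) => //; first exact/ltnW/lt.
by move=> y /and3P[_ _ /lt].
Qed.

End Restrict.

(** * The corona *)

Section CoronaColoring.
Variables (G1 G2 : sgraph) (l : nat).
Let V := vertex (corona G1 G2).
Let n := #|G2|.
Variables (sg : V -> V -> bool) (e : rel V).
Hypotheses (sgC : forall u w, sg u w = sg w u) (eC : symmetric e)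
  (eadj : subrel e (@adj (corona G1 G2))) (l0 : 0 < l).

Definition corona_base : {set V} := [set inl x | x in G1].

(** Here [e] stands for the edges left after colour 0 has been assigned; [pendant0] and [pendant1]
    distinguish whether a vertex of G1 has lost a pendant edge to colour 0. *)
Hypotheses
  (degl : forall x : G1, deg e (inl x) <= l.*2)
  (core : forall x y : G1, e (inl x) (inl y) ->
     deg (restrict e corona_base) (inl x) < l.*2 \/ deg (restrict e corona_base) (inl y) < l.*2)
  (pendant0 : forall (x : G1) (a : G2), ~~ e (inl x) (inr (x, a)) -> n + 1 <= l.*2)
  (pendant1 : forall x : G1, (forall a : G2, e (inl x) (inr (x, a))) ->
     n + 2 <= l.*2 \/ n <= 1).

Let eI : irreflexive e.
Proof. by move=> u; apply/negP => /eadj; rewrite adj_irr. Qed.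

Lemma corona_baseP u : reflect (exists x, u = inl x) (u \in corona_base).
Proof. by apply: (iffP imsetP) => [[x _ ->]|[x ->]]; exists x. Qed.

(** A vertex of a copy has at most n - 1 neighbours in the copy, and [inl x] takes the place of b
    itself in the count; vertices of the copy outside [A] are subtracted. *)
Lemma deg_copy (A : {set V}) (x : G1) (b : G2) (c0 : {set G2}) :
  (forall c, c \in c0 -> c != b /\ inr (x, c) \notin A) ->
  deg (restrict e A) (inr (x, b)) + #|c0| <= n.
Proof.
move=> c0P; pose h (c : G2) : V := if c == b then inl x else inr (x, c).
have sub : [set w | restrict e A (inr (x, b)) w] \subset h @: ~: c0.
  apply/subsetP => w; rewrite inE => /and3P[/eadj bw _ wA]; apply/imsetP.
  case: w bw wA => [y|[y c]] /=.
    move/eqP=> <- _; exists b; last by rewrite /h eqxx.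
    by rewrite inE; apply/negP => /c0P[]; rewrite eqxx.
  case/andP=> /eqP <- bc cA; have cb : c != b.
    by apply: contraTneq bc => ->; rewrite adj_irr.
  exists c; last by rewrite /h (negPf cb).
  by rewrite inE; apply/negP => /c0P[_]; rewrite cA.
rewrite /n -(cardsC c0) [X in _ <= X]addnC leq_add2r.
exact: leq_trans (subset_leq_card sub) (leq_imset_card _ _).
Qed.

(** Copy vertices whose pendant edge is absent from [e] are deleted first, then the other copy
    vertices, until only G1 remains and [colorable_core] applies. *)
Lemma corona_colorable : colorable l sg e.
Proof.
suff H (A : {set V}) : corona_base \subset A -> colorable l sg (restrict e A).
  have /eq_colorable : restrict e setT =2 e by move=> u w; rewrite /restrict !inE !andbT.
  by apply; apply: H; apply: subsetT.
have [m] := ubnP #|A|; elim: m A => // m IH A Am cA.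
have del (v : V) (X : {set V}) : v \in A -> v \notin corona_base ->
    deg (restrict e A) v <= l.*2 ->
    (forall x, x \in X -> restrict e A v x /\ deg (restrict e A) x <= l.*2) -> #|X| <= 1 ->
    (forall y, restrict e A v y -> y \notin X -> deg (restrict e A) y + 1 + #|X| <= l.*2) ->
    colorable l sg (restrict e A).
  move=> vA vc dv dX X1 dN; apply: (colorable_del sgC eC eI vA dv dX X1 dN).
  apply: IH; last by rewrite subsetD1 cA.
  by rewrite -ltnS (leq_trans _ Am) // [X in _ < X.+1](cardsD1 v) vA.
have inrc p : inr p \notin corona_base by apply/corona_baseP => -[].
have [/existsP[[x a] /= /andP[vA ea]]|no] :=
    boolP [exists p : G1 * G2, (inr p \in A) && ~~ e (inl p.1) (inr p)].
  have n1 := pendant0 ea.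
  have dA b : deg (restrict e A) (inr (x, b)) + 1 <= l.*2.
    apply: leq_trans n1; rewrite leq_add2r.
    by have := @deg_copy A x b set0; rewrite cards0 addn0; apply=> c; rewrite inE.
  apply: (del (inr (x, a)) set0) => //; rewrite ?cards0 //.
  - by apply: leq_trans (dA a); apply: leq_addr.
  - by move=> u; rewrite inE.
  - case=> [y|[y b]] /and3P[eay _ _] _; have /= := eadj eay.
      by move=> /eqP Exy; move: eay; rewrite -Exy eC (negPf ea).
    by case/andP=> /eqP <- _; rewrite addn0.
have Ae p : inr p \in A -> e (inl p.1) (inr p).
  by move=> pA; move: no; rewrite negb_exists => /forallP/(_ p); rewrite pA negbK.
have [/existsP[[x a] vA]|noc] := boolP [exists p : G1 * G2, inr p \in A].
  have xA y : inl y \in A by apply: (subsetP cA); apply/corona_baseP; exists y.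
  have dA b : deg (restrict e A) (inr (x, b)) <= n.
    by have := @deg_copy A x b set0; rewrite cards0 addn0; apply=> c; rewrite inE.
  (* The attachment vertex may have full degree 2l and so lack spare missing colours; it is put into
     [X]. *)
  apply: (del (inr (x, a)) [set inl x]) => //; rewrite ?cards1 //.
  - apply: leq_trans (dA a) _.
    have [/forallP/pendant1|] := boolP [forall b, e (inl x) (inr (x, b))].
      by case=> ?; lia.
    by rewrite negb_forall => /existsP[b /pendant0]; lia.
  - move=> u; rewrite inE => /eqP ->; rewrite /restrict eC (Ae (x, a)) // vA xA; split=> //.
    exact: leq_trans (leq_deg _ _ _) (degl x).
  - case=> [y|[y b]] /and3P[eay _ bA]; have /= := eadj eay.
      by move=> /eqP <-; rewrite inE eqxx.
    case/andP=> /eqP Exy ab _; rewrite -{y}Exy in eay bA *.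
    have [/forallP/pendant1|] := boolP [forall b, e (inl x) (inr (x, b))].
      case=> [|n1]; first by have := dA b; lia.
      (* The case n <= 1 cannot occur, since a and b are distinct vertices of the copy. *)
      have : 1 < #|G2|; last by rewrite /n in n1; lia.
      rewrite (cardD1 a) (cardD1 b) !inE /= !andbT.
      by have -> : b != a by apply: contraTneq ab => ->; rewrite adj_irr.
    rewrite negb_forall => /existsP[c ec]; have nl := pendant0 ec.
    (* The vertex c has no pendant edge in [e], hence is already deleted, which improves the degree
       bound at b by one. *)
    have := @deg_copy A x b [set c]; rewrite !cards1 -addnA => d.
    apply: leq_trans nl; rewrite addnA leq_add2r; apply: d => d.
    rewrite inE => /eqP ->; split; last by apply: contra ec => /Ae.
    by apply: contraNneq ec => ->; apply: Ae (x, b) bA.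
have EA : A = corona_base.
  apply/eqP; rewrite eqEsubset cA andbT; apply/subsetP => -[x _|p pA].
    by apply/corona_baseP; exists x.
  by move: noc; rewrite negb_exists => /forallP/(_ p); rewrite pA.
rewrite EA; apply: (@colorable_core _ _ sg e sgC eC eI corona_base) => //.
  move=> u; have [/corona_baseP[x ->]|uc] := boolP (u \in corona_base).
    exact: leq_trans (leq_deg _ _ _) (degl x).
  rewrite /deg (_ : [set _ | _] = set0) ?cards0 //.
  by apply/setP => w; rewrite !inE /restrict (negPf uc) andbF.
by move=> u w /and3P[euw /corona_baseP[x Ex] /corona_baseP[y Ey]]; rewrite Ex Ey in euw *;
  apply: core.
Qed.

End CoronaColoring.

(** * Incidence colourings *)

Section Incidences.
Variable G : sgraph.

(** The default is never taken, since an edge has two distinct ends. *)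
Definition opposite (i : incidence G) : G :=
  odflt (inc_vertex i)
    [pick w | (w \in val (inc_edge i)) && (w != inc_vertex i)].

Lemma edge_setP (e : {set G}) :
  reflect (exists u w, adj u w /\ e = [set u; w]) (e \in edge_set G).
Proof.
apply: (iffP imset2P) => [[u w _]|[u [w [uw ->]]]].
  by rewrite inE => /andP[_ uw] ->; exists u, w.
by exists u w; rewrite // !inE.
Qed.

Lemma opposite_adj (i : incidence G) :
  adj (inc_vertex i) (opposite i) /\
  val (inc_edge i) = [set inc_vertex i; opposite i].
Proof.
rewrite /opposite; case: i => -[v [e eE]] /= ve; rewrite /inc_vertex /inc_edge /=.
have [x [y [xy Ee]]] := edge_setP _ eE.
rewrite /= Ee !inE in ve *; have xyn : x != y by apply: contraTneq xy => ->; rewrite adj_irr.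
case: pickP => [w /andP[]|none] /=.
  rewrite !inE; case/orP: ve => /eqP ->; case/orP => /eqP ->; rewrite ?eqxx // => _.
  by rewrite adj_sym setUC.
case/orP: ve none => /eqP ->.
  by move=> /(_ y); rewrite !inE eqxx orbT eq_sym xyn.
by move=> /(_ x); rewrite !inE eqxx xyn.
Qed.

Lemma incidence_edge_inj (i j : incidence G) : inc_vertex i = inc_vertex j ->
  opposite i = opposite j -> inc_edge i = inc_edge j.
Proof.
move=> Ev Eo; apply: val_inj; have [_ ->] := opposite_adj i.
by have [_ ->] := opposite_adj j; rewrite Ev Eo.
Qed.

Lemma opposite_other (i j : incidence G) : inc_edge i = inc_edge j ->
  inc_vertex i <> inc_vertex j -> opposite i = inc_vertex j.
Proof.
move=> Ee ne; have [_ Ei] := opposite_adj i; have [_ Ej] := opposite_adj j.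
have : inc_vertex j \in val (inc_edge i) by rewrite Ee Ej !inE eqxx.
by rewrite Ei !inE => /orP[/eqP E|/eqP //]; case: ne.
Qed.

Lemma opposite_surj (v u : G) : adj v u ->
  exists i : incidence G, inc_vertex i = v /\ opposite i = u.
Proof.
move=> vu; have eE : [set v; u] \in edge_set G by apply/edge_setP; exists v, u.
have ve : v \in [set v; u] by rewrite !inE eqxx.
pose i : incidence G := exist _ (v, exist _ [set v; u] eE) ve.
exists i; split=> //; have [a E] := opposite_adj i.
have : opposite i \in [set v; u] by rewrite -[[set v; u]]/(val (inc_edge i)) E !inE eqxx orbT.
by rewrite !inE => /orP[/eqP Ev|/eqP //]; move: a; rewrite Ev adj_irr.
Qed.

Definition color_list (m : nat) : seq int :=
  [seq Posz i.+1 | i <- iota 0 m./2] ++ [seq (- Posz i.+1)%R | i <- iota 0 m./2]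
    ++ nseq (odd m) 0%R.

Lemma size_color_list m : size (color_list m) = m.
Proof.
rewrite !size_cat !size_map size_iota size_nseq addnA addnn addnC.
exact: odd_double_half.
Qed.

Lemma colors_list m c : c \in colors m -> c \in color_list m.
Proof.
rewrite inE => /andP[cm c0]; rewrite !mem_cat.
case: c cm c0 => [[|k]|k] /= cm c0.
- by case: (odd m) c0; rewrite // !mem_head !orbT.
- by rewrite map_f // mem_iota.
- by rewrite NegzE (map_f (fun i => - Posz i.+1)%R) ?orbT // mem_iota.
Qed.

(** The incidences at a vertex have distinct colours, and the list enumerating M_m has length m. *)
Lemma max_degree_lower (s : signature G) m :
  edge_colorable (SignedGraph s) m -> max_degree G <= m.
Proof.
case=> f [fc _ fI]; apply/bigmax_leqP => v _.
pose Iv := [set i : incidence G | inc_vertex i == v].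
have le1 : degree v <= #|Iv|.
  apply: leq_trans (leq_imset_card (@opposite) Iv); apply: subset_leq_card.
  apply/subsetP => u; rewrite inE => /opposite_surj[i [Ei Eo]].
  by apply/imsetP; exists i; rewrite // inE Ei.
apply: leq_trans le1 _; rewrite cardE -(size_map f) -[leqRHS](size_color_list m).
apply: uniq_leq_size => [|c /mapP[i _ ->]]; last exact/colors_list/fc.
rewrite map_inj_in_uniq ?enum_uniq // => i j; rewrite !mem_enum !inE.
move=> /eqP Ei /eqP Ej E; have Eij : inc_vertex i = inc_vertex j by rewrite Ei Ej.
have Ee : inc_edge i = inc_edge j.
  by apply/eqP; apply: contraPT E => /eqP; apply: fI Eij.
by apply: val_inj; rewrite [LHS]surjective_pairing [RHS]surjective_pairing; congr pair.
Qed.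

Definition edge_sign (s : signature G) (u w : G) : bool :=
  if insub [set u; w] is Some e then s e == 1%R else false.

Lemma edge_signC s u w : edge_sign s u w = edge_sign s w u.
Proof. by rewrite /edge_sign setUC. Qed.

Lemma edge_signE (s : signature G) (i : incidence G) :
  s (inc_edge i) = (if edge_sign s (inc_vertex i) (opposite i) then 1 else - 1)%R.
Proof.
have [_ E] := opposite_adj i; rewrite /edge_sign -E valK.
by case: (sign_pm1 s (inc_edge i)) => ->.
Qed.

(** Class i stands for i + 1 in absolute value, so 0 is never hit and remains free for the edges
    treated separately. *)
Definition int_of_color l (c : color l) : int :=
  if c.2 then Posz c.1.+1 else (- Posz c.1.+1)%R.

Lemma int_of_color_opp l (c : color l) :
  int_of_color (opp_color c) = (- int_of_color c)%R.
Proof. by case: c => i []; rewrite /int_of_color //= GRing.opprK. Qed.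

Lemma int_of_color_inj l : injective (@int_of_color l).
Proof.
case=> i b [j c]; rewrite /int_of_color /= => E.
have [Eb Ei] : b = c /\ i = j :> nat by case: b c E => [] [] E; split=> //; lia.
by rewrite Eb (ord_inj Ei).
Qed.

Lemma int_of_color_neq0 l (c : color l) : int_of_color c <> 0%R.
Proof. by case: c => i []; rewrite /int_of_color /=; lia. Qed.

Lemma int_of_color_in k (c : color k./2) : int_of_color c \in colors k.
Proof.
case: c => i b; have := ltn_ord i; rewrite inE /int_of_color /= => il.
by case: b; apply/andP; split; rewrite ?orbT //; lia.
Qed.

(* The edges outside e all receive colour 0. *)
Lemma edge_colorable_of (s : signature G) (e : rel G) k :
  symmetric e -> subrel e (@adj G) ->
  (forall u w, adj u w -> ~~ e u w -> odd k) ->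
  (forall u w w', adj u w -> ~~ e u w -> adj u w' -> ~~ e u w' -> w = w') ->
  colorable k./2 (edge_sign s) e -> edge_colorable (SignedGraph s) k.
Proof.
move=> eC eadj oddk zero [f [fE fI]].
pose g u w : int := if e u w then int_of_color (f u w) else 0%R.
exists (fun i => g (inc_vertex i) (opposite i)); split.
- move=> i; rewrite /g; case: ifP => [_|/negbT ne]; first exact: int_of_color_in.
  by rewrite inE /= (oddk _ _ (opposite_adj i).1 ne).
- move=> i j Ee ne; have Ej := opposite_other (esym Ee) (nesym ne).
  rewrite Ej (opposite_other Ee ne) /g eC /=.
  rewrite Ee edge_signE Ej; case: ifP => [eji|_]; last by rewrite GRing.mulr0.
  rewrite (fE _ _ eji); case: ifP => _ /=.
    by rewrite int_of_color_opp GRing.mulN1r.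
  by rewrite GRing.opprK GRing.mul1r.
- move=> i j Ev ne; have [ai _] := opposite_adj i; have [aj _] := opposite_adj j.
  have no : opposite i <> opposite j by move=> Eo; apply: ne; apply: incidence_edge_inj.
  rewrite /g Ev; rewrite Ev in ai; case: ifP => [ei|/negbT ei]; case: ifP => [ej|/negbT ej].
  + by move/int_of_color_inj => E; apply: no; apply: fI E.
  + exact: int_of_color_neq0.
  + by move/esym; apply: int_of_color_neq0.
  + by move=> _; apply: no; apply: zero ei aj ej.
Qed.

End Incidences.

(** * Maximal matchings of a graph *)

(** A graph matching as a symmetric set of ordered pairs, so that [dom P] is the set of vertices it
    covers. *)
Definition pairing (G : sgraph) (P : {set G * G}) :=
  [/\ forall x y, (x, y) \in P -> adj x y,
      forall x y, (x, y) \in P -> (y, x) \in P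
    & forall x y z, (x, y) \in P -> (x, z) \in P -> y = z].

Lemma pairing0 (G : sgraph) : @pairing G set0.
Proof. by split=> x y; rewrite ?inE // => z; rewrite inE. Qed.

Lemma maximal_pairing (G : sgraph) : exists P : {set G * G}, pairing P /\
  forall x y, adj x y -> x \in dom P \/ y \in dom P.
Proof.
suff H n (P : {set G * G}) : pairing P -> #|{: G * G}| - #|P| < n ->
    exists Q : {set G * G}, pairing Q /\
      forall x y, adj x y -> x \in dom Q \/ y \in dom Q.
  exact: H (pairing0 G) (ltnSn _).
elim: n P => // n IH P [Pa Ps Pf] Pn.
have [/existsP[[x y] /and3P[/= xy xP yP]]|no] := boolP [exists p : G * G,
    [&& adj p.1 p.2, p.1 \notin dom P & p.2 \notin dom P]]; last first.
  exists P; split=> // x y xy; apply/orP; move: no.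
  by rewrite negb_exists => /forallP/(_ (x, y)); rewrite /= xy /= -negb_or negbK.
have xP' z : (x, z) \notin P by apply: contra xP => ?; apply/domP; exists z.
have yP' z : (y, z) \notin P by apply: contra yP => ?; apply/domP; exists z.
have nxy : x != y by apply: contraTneq xy => ->; rewrite adj_irr.
apply: (IH ((x, y) |: ((y, x) |: P))).
  split=> [u w|u w|u w w']; rewrite !inE !xpair_eqE.
  - by case/or3P=> [/andP[/eqP-> /eqP->]//|/andP[/eqP-> /eqP->]|/Pa//]; rewrite adj_sym.
  - case/or3P=> [/andP[/eqP-> /eqP->]|/andP[/eqP-> /eqP->]|/Ps ->]; by rewrite ?eqxx ?orbT.
  - have [->|ux] := eqVneq u x;
      first by rewrite (negPf nxy) !(negPf (xP' _)) !orbF => /eqP-> /eqP->.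
    have [->|uy] /= := eqVneq u y; first by rewrite !(negPf (yP' _)) !orbF => /eqP-> /eqP->.
    exact: Pf.
have lt : #|P| < #|(x, y) |: ((y, x) |: P)|.
  apply: proper_card; rewrite properEneq; apply/andP; split.
    by apply: contraNneq (xP' y) => ->; rewrite setU11.
  by apply: subset_trans (subsetUr _ _) (subsetUr _ _).
rewrite ltnS in Pn; apply: leq_trans Pn; apply: (ltn_sub2l _ lt).
exact: leq_trans lt (max_card _).
Qed.

(** * Degrees in the corona and the two parities *)

Section Corona.
Variables G1 G2 : sgraph.
Let V := vertex (corona G1 G2).
Let n := #|G2|.

Lemma degree_inl (x : G1) : degree (inl x : corona G1 G2) = degree x + n.
Proof.
rewrite /degree /n -cardsT.
pose A : {set V} := inl @: [set y | adj x y].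
pose B : {set V} := (fun a => inr (x, a)) @: [set: G2].
have -> : [set u : corona G1 G2 | adj (inl x : corona G1 G2) u] = A :|: B.
  apply/setP => -[y|[y a]]; rewrite !inE /=.
    have -> : (inl y \in B) = false by apply/imsetP => -[].
    by rewrite orbF mem_imset ?inE // => ? ? [].
  have -> : (inr (y, a) \in A) = false by apply/imsetP => -[].
  apply/eqP/imsetP => [->|[b _ [-> _]]//]; by exists a.
rewrite cardsU (_ : A :&: B = set0) ?cards0 ?subn0; last first.
  apply/setP => u; rewrite !inE; apply/andP => -[/imsetP[y _ ->]].
  by case/imsetP.
by congr (_ + _); apply: card_imset => ? ? [].
Qed.

Lemma degree_max (x : G1) : degree x + n <= max_degree (corona G1 G2).
Proof. by rewrite -degree_inl; apply: (leq_bigmax (inl x : corona G1 G2)). Qed.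

Lemma max_degree_ge : 2 <= max_degree G1 -> n + 2 <= max_degree (corona G1 G2).
Proof.
move=> d2; have [/existsP[x dx]|no] := boolP [exists x : G1, 2 <= degree x].
  by apply: leq_trans (degree_max x); rewrite addnC leq_add2r.
have : max_degree G1 <= 1; last by move=> /(leq_trans d2).
apply/bigmax_leqP => x _; rewrite leqNgt.
by move: no; rewrite negb_exists => /forallP/(_ x).
Qed.

Lemma leq_deg_core (e : rel V) (x : G1) : subrel e (@adj (corona G1 G2)) ->
  deg (restrict e (corona_base G1 G2)) (inl x) <= degree x.
Proof.
move=> eadj; have inlI : injective (inl : G1 -> V) by move=> ? ? [].
rewrite /degree -(card_imset _ inlI); apply: subset_leq_card.
apply/subsetP => u; rewrite inE => /and3P[/eadj xu _ /corona_baseP[y Ey]].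
by rewrite {u}Ey in xu *; rewrite mem_imset ?inE.
Qed.

Section TwoParities.
Variables (sg : V -> V -> bool) (l : nat).
Hypothesis sgC : forall u w, sg u w = sg w u.

(** No edge gets colour 0. Each vertex of G1 has at least one pendant edge, so its degree inside G1
    is below 2l and the core condition holds. *)
Lemma corona_colorable_even : n + 2 <= l.*2 ->
  (forall x : G1, degree x + n <= l.*2) -> colorable l sg (@adj (corona G1 G2)).
Proof.
move=> nl dl; have n0 : 0 < n := vertex_gt0 G2.
apply: corona_colorable => //.
- exact: adj_sym.
- lia.
- by move=> x; rewrite -[deg _ _]/(degree (inl x : corona G1 G2)) degree_inl.
- move=> x y _; left; apply: leq_ltn_trans (leq_deg_core x (fun _ _ => id)) _.
  by have := dl x; lia.
- by move=> x a; rewrite /= eqxx.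
- by move=> x _; left.
Qed.

Lemma corona_colorable_odd (P : {set G1 * G1}) (a0 : G2) :
  pairing P -> (n != 1 -> P = set0) ->
  (n = 1 -> forall x y, adj x y -> x \in dom P \/ y \in dom P) ->
  n + 1 <= l.*2 -> (forall x : G1, degree x + n <= l.*2.+1) ->
  exists e : rel V, [/\ symmetric e, subrel e (@adj (corona G1 G2)),
    forall u w w', @adj (corona G1 G2) u w -> ~~ e u w ->
      @adj (corona G1 G2) u w' -> ~~ e u w' -> w = w'
    & colorable l sg e].
Proof.
case=> Pa Ps Pf P0 Pmax nl dl; have n0 : 0 < n := vertex_gt0 G2.
(* The edges of colour 0: those of [P], and the pendant edge to [a0] at each vertex of G1 that [P]
   leaves uncovered. *)
pose zero (u w : V) := match u, w with
  | inl x, inl y => (x, y) \in P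
  | inl x, inr (y, a) | inr (y, a), inl x => [&& x == y, a == a0 & x \notin dom P]
  | _, _ => false end.
have zeroC : symmetric zero.
  by move=> [x|[x a]] [y|[y b]] //=; apply/idP/idP; apply: Ps.
have zadj : subrel zero (@adj (corona G1 G2)).
  move=> [x|[x a]] [y|[y b]] //=; first exact: Pa.
    by case/andP.
  by case/andP; rewrite eq_sym.
pose e : rel V := fun u w => @adj (corona G1 G2) u w && ~~ zero u w.
have nzero u w : @adj (corona G1 G2) u w -> ~~ e u w -> zero u w.
  by rewrite /e => ->; rewrite negbK.
have eC : symmetric e by move=> u w; rewrite /e adj_sym zeroC.
have eadj : subrel e (@adj (corona G1 G2)) by move=> u w /andP[].
have zero_ex (x : G1) : exists w, zero (inl x) w.
  have [/domP[y xy]|xP] := boolP (x \in dom P); first by exists (inl y).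
  by exists (inr (x, a0)); rewrite /= !eqxx.
have degS (x : G1) : deg e (inl x) < degree (inl x : corona G1 G2).
  have [w xw] := zero_ex x; apply: proper_card; apply/properP; split.
    by apply/subsetP => u; rewrite !inE => /eadj.
  by exists w; rewrite inE ?zadj // /e xw andbF.
exists e; split=> //.
  move=> u w w' uw /(nzero _ _ uw) zw uw' /(nzero _ _ uw') zw'; move: zw zw'.
  have notP x y : (x, y) \in P -> x \notin dom P -> False.
    by move=> xy /negP; apply; apply/domP; exists y.
  case: u w w' {uw uw'} => [x|[x a]] [y|[y b]] [y'|[y' b']] //=.
  - by move=> xy xy'; rewrite (Pf _ _ _ xy xy').
  - by move=> xy /and3P[_ _ /(notP _ _ xy)].
  - by move=> /and3P[_ _ xP] xy; case: (notP _ _ xy xP).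
  - by move=> /and3P[/eqP-> /eqP-> _] /and3P[/eqP-> /eqP-> _].
  - by move=> /and3P[/eqP-> _ _] /and3P[/eqP-> _ _].
apply: corona_colorable => //.
- lia.
- by move=> x; rewrite -ltnS; apply: leq_trans (degS x) _; rewrite degree_inl; apply: dl.
- move=> x y /andP[/= xy xyP].
  have [n1|n1] := eqVneq n 1; last first.
    have n2 : 1 < n by rewrite ltn_neqAle eq_sym n1.
    by left; apply: leq_ltn_trans (leq_deg_core x eadj) _; have := dl x; lia.
  (* With n = 1 the degree inside G1 may reach 2l; a covered vertex loses one edge of G1 to colour
     0, and by maximality every edge of G1 has a covered end. *)
  have H z : z \in dom P -> deg (restrict e (corona_base G1 G2)) (inl z) < l.*2.
    case/domP=> z' zz'; have : deg (restrict e (corona_base G1 G2)) (inl z) < degree z.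
      have inlI : injective (inl : G1 -> V) by move=> ? ? [].
      rewrite /degree -(card_imset _ inlI); apply: proper_card; apply/properP; split.
        apply/subsetP => u; rewrite inE => /and3P[/eadj zu _ /corona_baseP[t Et]].
        by rewrite {u}Et in zu *; rewrite mem_imset ?inE.
      by exists (inl z'); rewrite ?mem_imset ?inE ?Pa // /restrict /e /= zz' andbF.
    by have := dl z; lia.
  by case: (Pmax n1 x y xy) => /H; [left|right].
(* If x keeps all its pendant edges, then x is covered by [P]; so [P] is nonempty, which forces n =
   1. *)
- move=> x ex; right; have xP : x \in dom P.
    by apply: contraT => xP; have := ex a0; rewrite /e /= !eqxx xP.
  have [n1|n1] := eqVneq n 1; first by rewrite -/n n1.
  by rewrite (P0 n1) /dom imset0 inE in xP.
Qed.

End TwoParities.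
End Corona.

Theorem theorem24 (G1 G2 : sgraph) (s : signature (corona G1 G2)) :
  2 <= max_degree G1 ->
  is_chromatic_index (SignedGraph s) (max_degree (SignedGraph s)).
Proof.
move=> d2; have nk := max_degree_ge G2 d2; set k := max_degree _ in nk *.
have dk : forall x : G1, degree x + #|G2| <= k := @degree_max G1 G2.
have sgC := edge_signC s.
split; [lia| |by move=> m _; apply: max_degree_lower].
have n0 : 0 < #|G2| := vertex_gt0 G2.
have [ok|ek] := boolP (odd k); last first.
  have Ek : k./2.*2 = k by have := odd_double_half k; rewrite (negPf ek).
  apply: (@edge_colorable_of _ s (@adj (corona G1 G2))) => //.
  - exact: adj_sym.
  - by move=> u w ->.
  - by move=> u w w' ->.
  by apply: corona_colorable_even => // [|x]; rewrite Ek.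
have Ek : k./2.*2.+1 = k by have := odd_double_half k; rewrite ok.
have /card_gt0P[a0 _] := n0.
have [P [PP P0 Pmax]] : exists P : {set G1 * G1}, [/\ pairing P,
    #|G2| != 1 -> P = set0
  & #|G2| = 1 -> forall x y, adj x y -> x \in dom P \/ y \in dom P].
  have [n1|n1] := eqVneq #|G2| 1.
    by have [P [PP Pmax]] := maximal_pairing G1; exists P.
  by exists set0; split=> //; [exact: pairing0|move/eqP; rewrite (negPf n1)].
have [||e [eC eadj ez ecol]] := @corona_colorable_odd G1 G2 (edge_sign s) k./2 sgC P a0 PP P0 Pmax.
- lia.
- by move=> x; rewrite Ek.
by apply: (@edge_colorable_of _ s e).
Qed.
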